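(* Let $K$ and $L$ be Lie groups with Lie algebras $\mathfrak{k}$ and $\mathfrak{l}$, let $H=U(\mathfrak{k})\,\triangleright\!\!\!\blacktriangleleft F(L)$ be a bicrossproduct Hopf algebra and $H^*=F(K)\blacktriangleright\!\!\!\triangleleft\,U(\mathfrak{l})$ its dual. Let $l\in L$ be an element supporting a global action of the group $K$ (i.e. $k\triangleright l$ is defined for all $k\in K$, and the action is global on the orbit of $l$). (i) The carrier space $\mathbb{C}^\uparrow$ of the representation of $H$ induced by the character $1\dashv\lambda=\lambda(l)$ of $F(L)$ is the set of elements of $H^*$ of the form $\kappa l$ with $\kappa\in F(K)$, and the map $\kappa\mapsto\kappa l$ is an isomorphism between $F(K)$ and $\mathbb{C}^\uparrow$. (ii) The action induced on $F(K)$ by the elements $k\in K$ and $\lambda\in F(L)$ is $$\kappa\dashv k=\kappa\prec k,\qquad \kappa\dashv\lambda=\kappa\,(\lambda\circ\hat l),$$ where $\hat l:K\to L$, $\hat l(k)=k\triangleright l$. (iii) The modules induced by $l$ and by $k\triangleright l$ ($k\in K$) are isomorphic; so the induction algorithm establishes a correspondence between the space of orbits $L/K$ and the set of equivalence classes of (induced) representations. (iv) If $K$ is compact, the induced representation is unitary in the space $L^2(K)$ of square-integrable functions with respect to the right invariant Haar measure, when $H$ carries the $*$-structure $(k\lambda)^*=\lambda^*k^*$ obtained from the natural $*$-structures of the factors, $k^*=k^{-1}$ for $k\in K$ and $\lambda^*(l')=\overline{\lambda(l')}$ for $\lambda\in F(L)$, $l'\in L$.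
   Context: $F(K)$, $F(L)$ denote the algebras of $\mathbb{C}$-valued smooth functions on $K$, $L$. In the bicrossproduct $H=U(\mathfrak{k})\triangleright\!\!\!\blacktriangleleft F(L)$, $F(L)$ is a right $U(\mathfrak{k})$-module algebra (action $\triangleleft$), $U(\mathfrak{k})$ is a left $F(L)$-comodule coalgebra, and these satisfy the usual compatibility conditions; the product on $U(\mathfrak{k})\otimes F(L)$ (write $k\lambda=k\otimes\lambda$) is $(k\otimes\lambda)(k'\otimes\lambda')=kk'_{(1)}\otimes(\lambda\triangleleft k'_{(2)})\lambda'$. $H^*=F(K)\blacktriangleright\!\!\!\triangleleft U(\mathfrak{l})$ is the dual bicrossproduct, with underlying space $F(K)\otimes U(\mathfrak{l})$ (write $\kappa l=\kappa\otimes l$). Elements $k\in K$ are regarded as group-like elements of (a completion of) $U(\mathfrak{k})$ and $l\in L$ as group-like elements of (a completion of) $U(\mathfrak{l})$; $H$ and $H^*$ are described by the elements $k\lambda$ and $\kappa l$. The pairing is $\langle k\lambda,\kappa l\rangle=\kappa(k)\lambda(l)$. The action of $U(\mathfrak{k})$ on $F(L)$ corresponds to a left action $(k,l)\mapsto k\triangleright l$ of $K$ on $L$ (in general only local): $(\lambda\triangleleft k)(l)=\lambda(k\triangleright l)$. Regular actions: on $H^*$, $\langle h,h'\succ\eta\rangle=\langle hh',\eta\rangle$ and $\langle h,\eta\prec h'\rangle=\langle h'h,\eta\rangle$; on $F(K)$, $(\kappa\prec k')(k)=\kappa(k'k)$. Induced representation: the carrier space of the representation induced by the character $\lambda\mapsto\lambda(l)$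 is $\mathbb{C}^\uparrow=\{f\in H^*:\lambda\succ f=\lambda(l)f\ \ \forall\lambda\in F(L)\}$, with right $H$-action given by the right regular action $f\dashv h=f\prec h$; via $\kappa\mapsto\kappa l$ it is transported to $F(K)$. Unitarity means compatibility of the action with the $*$-structure and the $L^2$ inner product: $(\phi\dashv h,\phi')=(\phi,\phi'\dashv h^* )$ for $h\in H$ and smooth $\phi,\phi'$ on $K$; in particular $k\in K$ acts unitarily. *)

(* Defs.v *)
From HB Require Import structures.
From mathcomp Require Import all_boot all_order all_algebra complex.
From mathcomp Require Import all_classical all_reals all_analysis.

Set Implicit Arguments.
Unset Strict Implicit.
Unset Printing Implicit Defensive.

Import Order.TTheory GRing.Theory Num.Theory numFieldNormedType.Exports.
Local Open Scope classical_set_scope.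
Local Open Scope ring_scope.

Section Calculus.
Variable R : realType.

Fixpoint Cn_on m (W : normedModType R) (n : nat) (U : set 'rV[R]_m)
    (f : 'rV[R]_m -> W) : Prop :=
  if n is n'.+1 then
    (forall x, U x -> differentiable f x) /\
    (forall v, Cn_on n' U ('D_v f))
  else forall x, U x -> {for x, continuous f}.

(* Meaningful for open U only; the values of f outside U are irrelevant. *)
Definition smooth_on m (W : normedModType R) (U : set 'rV[R]_m)
    (f : 'rV[R]_m -> W) : Prop :=
  forall n, Cn_on n U f.

End Calculus.

Section Manifolds.
Variable R : realType.

Record chart (M : Type) (m : nat) := Chart {
  chart_dom : set M;
  chart_map :> M -> 'rV[R]_m;
  chart_inv : 'rV[R]_m -> M }.

Definition chart_cod M m (c : chart M m) : set 'rV[R]_m := c @` chart_dom c.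

Definition chart_axiom (M : topologicalType) m (c : chart M m) : Prop :=
  [/\ open (chart_dom c), open (chart_cod c),
      forall x, chart_dom c x -> chart_inv c (c x) = x,
      forall x, chart_dom c x -> {for x, continuous c} &
      forall y, chart_cod c y -> {for y, continuous (chart_inv c)}].

Definition smooth_atlas (M : topologicalType) m (A : set (chart M m)) : Prop :=
  [/\ forall c, A c -> chart_axiom c,
      forall x, exists2 c, A c & chart_dom c x &
      forall c d, A c -> A d ->
        smooth_on (c @` (chart_dom c `&` chart_dom d)) (d \o chart_inv c)].

Definition prod_chart M N m n (c : chart M m) (d : chart N n) :
    chart (M * N) (m + n) :=
  Chart (chart_dom c `*` chart_dom d)
        (fun p => row_mx (c p.1) (d p.2))
        (fun y => (chart_inv c (lsubmx y), chart_inv d (rsubmx y))).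

Definition prod_atlas M N m n (A : set (chart M m)) (B : set (chart N n)) :
    set (chart (M * N) (m + n)) :=
  [set e | exists c d, [/\ A c, B d & e = prod_chart c d]].

(* Smoothness of f on the open set D, in terms of atlases A and B. *)
Definition smooth_map (M N : topologicalType) m n
    (A : set (chart M m)) (B : set (chart N n)) (D : set M) (f : M -> N) : Prop :=
  (forall x, D x -> {for x, continuous f}) /\
  (forall c d, A c -> B d ->
     smooth_on (c @` (chart_dom c `&` D `&` f @^-1` chart_dom d))
               (d \o f \o chart_inv c)).

End Manifolds.

(* Group and topology on the same carrier; that the operations are continuous
   (indeed smooth) is required in lieGroup. *)
#[short(type="ptopGroupType")]
HB.structure Definition PTopGroup := {G of Group G & PointedTopological G}.

Record lieGroup (R : realType) := LieGroup {
  lie_car :> ptopGroupType;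
  lie_dim : nat;
  lie_atlas : set (chart R lie_car lie_dim);
  lie_hausdorff : hausdorff_space lie_car;
  lie_second_countable : @second_countable lie_car;
  lie_atlasP : smooth_atlas lie_atlas;
  lie_mul_smooth : smooth_map (prod_atlas lie_atlas lie_atlas) lie_atlas setT
    (fun p : (lie_car * lie_car)%type => (p.1 * p.2)%g);
  lie_inv_smooth : smooth_map lie_atlas lie_atlas setT
    (fun x : lie_car => x^-1%g) }.

Section Distributions.
Variables (R : realType) (G : lieGroup R).
Local Notation C := R[i].

(* The algebra F(G). *)
Definition smoothC : set (G -> C) :=
  [set f | forall c, lie_atlas c ->
     smooth_on (chart_cod c) ((fun x => complex.Re (f x) : R^o) \o chart_inv c) /\
     smooth_on (chart_cod c) ((fun x => complex.Im (f x) : R^o) \o chart_inv c)].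

(* Functionals on functions; only their values on functions that are smooth
   near the relevant points are meaningful. *)
Definition functional := (G -> C) -> C.

Definition grouplike (g : G) : functional := fun f => f g.

(* Derivative at the identity, in the chart c and in the direction v: these are
   the elements of the Lie algebra. *)
Definition tangent (c : chart R G (lie_dim G)) (v : 'rV[R]_(lie_dim G)) :
    functional :=
  fun f => Complex
    ('D_v ((fun x => complex.Re (f x) : R^o) \o chart_inv c) (c 1%g))
    ('D_v ((fun x => complex.Im (f x) : R^o) \o chart_inv c) (c 1%g)).

Definition conv (u v : functional) : functional :=
  fun f => u (fun g => v (fun g' => f (g * g')%g)).

(* The completed (complex) enveloping algebra U^(g). U(g) is realised as the
   convolution algebra generated by the Lie algebra, i.e. as the distributions
   supported at the identity (X f is the value at the identity of the
   left-invariant differential operator X applied to f); the completion adjoins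
   the elements of G as group-likes. The product is convolution, and the
   coproduct is dual to the pointwise product: u(f f') = u_(1)(f) u_(2)(f'). *)
Inductive inU : set functional :=
| inU_grouplike g : inU (grouplike g)
| inU_tangent c v : lie_atlas c -> chart_dom c 1%g -> inU (tangent c v)
| inU_lin (a : C) u v : inU u -> inU v -> inU (fun f => a * u f + v f)
| inU_conv u v : inU u -> inU v -> inU (conv u v).

(* The antilinear antimultiplicative involution with k^* = k^-1 on group-likes,
   hence X^* = - X on the (real) Lie algebra. *)
Definition starU (u : functional) : functional :=
  fun f => conjc (u (fun g => conjc (f g^-1%g))).

Definition starF (f : G -> C) : G -> C := fun g => conjc (f g).

End Distributions.

Section Bicrossproduct.
Variables (R : realType) (K L : lieGroup R).
Local Notation C := R[i].

(* Matched pair of Lie groups with, in general, only local actions: lact is the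
   left action k |> l of K on L and ract the right action k <| l of L on K.
   They are meaningful on the open sets ldom and rdom only, and the identities
   are required whenever all the terms are defined. *)
Record matched_pair := MatchedPair {
  lact : K -> L -> L;
  ract : K -> L -> K;
  ldom : set (K * L);
  rdom : set (K * L);
  ldom_open : open ldom;
  rdom_open : open rdom;
  ldom1l : forall l, ldom (1%g, l);
  ldom1r : forall k, ldom (k, 1%g);
  rdom1l : forall l, rdom (1%g, l);
  rdom1r : forall k, rdom (k, 1%g);
  lact_smooth : smooth_map (prod_atlas (@lie_atlas _ K) (@lie_atlas _ L))
    (@lie_atlas _ L) ldom (fun p => lact p.1 p.2);
  ract_smooth : smooth_map (prod_atlas (@lie_atlas _ K) (@lie_atlas _ L))
    (@lie_atlas _ K) rdom (fun p => ract p.1 p.2);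
  lact1l : forall l, lact 1%g l = l;
  lact1r : forall k, lact k 1%g = 1%g;
  ract1l : forall l, ract 1%g l = 1%g;
  ract1r : forall k, ract k 1%g = k;
  lactA : forall k k' l,
    ldom (k', l) -> ldom (k, lact k' l) -> ldom ((k * k')%g, l) ->
    lact (k * k')%g l = lact k (lact k' l);
  ractA : forall k l l',
    rdom (k, l) -> rdom (ract k l, l') -> rdom (k, (l * l')%g) ->
    ract k (l * l')%g = ract (ract k l) l';
  lactM : forall k l l',
    ldom (k, (l * l')%g) -> ldom (k, l) -> rdom (k, l) ->
    ldom (ract k l, l') ->
    lact k (l * l')%g = (lact k l * lact (ract k l) l')%g;
  ractM : forall k k' l,
    rdom ((k * k')%g, l) -> ldom (k', l) -> rdom (k, lact k' l) ->
    rdom (k', l) ->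
    ract (k * k')%g l = (ract k (lact k' l) * ract k' l)%g }.

Variable mp : matched_pair.

Definition global_at (l : L) : Prop :=
  (forall k, ldom mp (k, l)) /\ (forall k k', ldom mp (k', lact mp k l)).

Definition Korbit (l : L) : set L := range (fun k => lact mp k l).

(* An element sum_i u_i (x) lambda_i of U^(k) (x) F(L) is represented by the
   family of functionals l |-> (kappa |-> sum_i u_i(kappa) lambda_i(l)); only
   the values at kappa in F(K) matter. *)
Definition hfam := L -> functional K.

Definition tens (u : functional K) (lam : L -> C) : hfam :=
  fun l kap => u kap * lam l.

Definition tens_sum n (u : 'I_n -> functional K) (lam : 'I_n -> L -> C) : hfam :=
  fun l kap => \sum_(i < n) tens (u i) (lam i) l kap.

Definition inH : set hfam :=
  [set h | exists n (u : 'I_n -> functional K) (lam : 'I_n -> L -> C),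
     (forall i, inU (u i) /\ smoothC (lam i)) /\ h = tens_sum u lam].

(* The product
     (u (x) lam)(u' (x) lam') = u u'_(1) (x) (lam <| u'_(2)) lam',
   where (lam <| u)(l) = u (k |-> lam (k |> l)): evaluated at l and kappa, the
   right-hand side is u'(k' |-> lam(k' |> l) u(k |-> kappa(k k'))) lam'(l),
   since the coproduct of u' is dual to the pointwise product. When the action
   is only local, (lam <| k') is only defined at the l with (k', l) in ldom, and
   the product of two elements of H need not belong to H. *)
Definition mulH (h h' : hfam) : hfam :=
  fun l kap => h' l (fun k' => h (lact mp k' l) (fun k => kap (k * k')%g)).

Lemma mulH_grouplike (k k' : K) (lam lam' : L -> C) :
  mulH (tens (grouplike k) lam) (tens (grouplike k') lam') =
  tens (grouplike (k * k')%g) (fun l => lam (lact mp k' l) * lam' l).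
Proof.
by apply/funext => l; apply/funext => kap; rewrite /mulH /tens /grouplike mulrA.
Qed.

Definition Hel := {h : hfam | inH h}.

(* Equality of h'' and h h' as elements of the completion. *)
Definition prodH (h h' h'' : hfam) : Prop :=
  forall l kap, smoothC kap -> h'' l kap = mulH h h' l kap.

Definition hdual := Hel -> C.

(* The element kappa (x) v of F(K) (x) U^(l), paired with H through
   <u lam, kappa v> = u(kappa) v(lam). *)
Definition dtens (kap : K -> C) (v : functional L) : hdual :=
  fun h => v (fun l => sval h l kap).

Lemma pairing_grouplike (h : Hel) (k : K) (lam : L -> C) (kap : K -> C) (l : L) :
  sval h = tens (grouplike k) lam ->
  dtens kap (grouplike l) h = kap k * lam l.
Proof. by rewrite /dtens /grouplike => ->. Qed.

Definition Hstar : set hdual :=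
  [set f | exists n (kap : 'I_n -> K -> C) (v : 'I_n -> functional L),
     (forall i, smoothC (kap i) /\ inU (v i)) /\
     f = (fun h => \sum_(i < n) dtens (kap i) (v i) h)].

(* f' = h0 > f (left) and f' = f < h0 (right regular action), defined by
   <h, h0 > f> = <h h0, f> and <h, f < h0> = <h0 h, f>, for all the h in H such
   that the product in question is an element h'' of H. This restriction is void
   if the action is global; otherwise there are still enough such h (the k mu with
   mu supported where k |> - is defined) to determine f < h0 when f = elt kap l
   and l supports a global action. *)
Definition lreg (h0 : hfam) (f f' : hdual) : Prop :=
  forall h h'' : Hel, prodH (sval h) h0 (sval h'') -> f' h = f h''.

Definition rreg (f : hdual) (h0 : hfam) (f' : hdual) : Prop :=
  forall h h'' : Hel, prodH h0 (sval h) (sval h'') -> f' h = f h''.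

Definition Kelt (k : K) : hfam := tens (grouplike k) (fun=> 1).
Definition Felt (lam : L -> C) : hfam := tens (grouplike 1%g) lam.

Definition ind_carrier (l : L) : set hdual :=
  [set f | Hstar f /\
     forall lam, smoothC lam -> lreg (Felt lam) f (fun h => lam l * f h)].

(* The element kappa l of H^*, for l in L. *)
Definition elt (kap : K -> C) (l : L) : hdual := dtens kap (grouplike l).

(* kap' is the image of kap under the action of h on F(K) obtained by transport
   along kap |-> elt kap l. *)
Definition ind_act (l : L) (kap : K -> C) (h : hfam) (kap' : K -> C) : Prop :=
  smoothC kap' /\ rreg (elt kap l) h (elt kap' l).

(* kap' is the image of kap under (u lam)^* = lam^* u^*, i.e. under lam^* and
   then u^* (their product need not lie in H if the action is only local). *)
Definition ind_act_star (l : L) (kap : K -> C) (u : functional K) (lam : L -> C)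
    (kap' : K -> C) : Prop :=
  exists2 psi, ind_act l kap (Felt (starF lam)) psi &
               ind_act l psi (tens (starU u) (fun=> 1)) kap'.

(* Isomorphism of right H-modules, for subspaces of H^* with the action rreg. *)
Definition module_iso (M N : set hdual) : Prop :=
  exists T : hdual -> hdual,
    [/\ set_bij M N T,
        forall (a : C) f g, M f -> M g ->
          T (fun h => a * f h + g h) = (fun h => a * T f h + T g h) &
        forall f f' h, M f -> M f' -> inH h -> rreg f h f' -> rreg (T f) h (T f')].

Definition iso_class (l : L) : set (set hdual) :=
  [set M | exists2 l', global_at l' & M = ind_carrier l' /\ module_iso (ind_carrier l) M].

Definition global_orbits : set (set L) := Korbit @` global_at.

Definition induced_classes : set (set (set hdual)) := iso_class @` global_at.

End Bicrossproduct.

Section Haar.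
Variables (R : realType) (K : lieGroup R).
Local Notation C := R[i].

Definition borelType := g_sigma_algebraType (@open K).

Definition right_haar (mu : {measure set borelType -> \bar R}) : Prop :=
  [/\ forall A : set K, compact A -> (mu A < +oo)%E,
      forall A : set K, open A -> A !=set0 -> (0 < mu A)%E &
      forall (A : set borelType) (k : K), measurable A ->
        mu [set (x * k)%g | x in (A : set K)] = mu A].

Definition L2dot (mu : {measure set borelType -> \bar R}) (f g : K -> C) : C :=
  Complex (\int[mu]_(x in setT) complex.Re (conjc (f x) * g x))
          (\int[mu]_(x in setT) complex.Im (conjc (f x) * g x)).

Definition square_integrable (mu : {measure set borelType -> \bar R}) (f : K -> C) :
    Prop :=
  [/\ measurable_fun setT (fun x : borelType => complex.Re (f x)),
      measurable_fun setT (fun x : borelType => complex.Im (f x)) &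
      (\int[mu]_(x in setT)
         (complex.Re (f x) ^+ 2 + complex.Im (f x) ^+ 2)%:E < +oo)%E].

End Haar.

(* Main.v *)
From HB Require Import structures.
From mathcomp Require Import all_boot all_order all_algebra complex.
From mathcomp Require Import all_classical all_reals all_analysis.
From mathcomp Require Import measurable_realfun ring lra.
Require Import Defs.

(* A map from an open subset of some R^m to a manifold is called a plot when it
   is smooth. Testing functions on plots shows that a distribution v in U^(g),
   applied to a function depending smoothly on parameters, gives a smooth
   function of the parameters; hence all v in U^(g) are linear on smooth
   functions and convolutions make sense.
   An element f of the carrier space satisfies f(u lam) = lam(l) f(u) =
   lam(l) u(kappa) with kappa(k) = f(k), so f = kappa l. On kappa the element h
   acts by (kappa <| h)(x) = h(x |> l)(kappa(- x)); this is the only solution of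
   the pairing condition because the k mu, with mu a bump function supported
   where k |> - is defined, separate points. Right translation by k intertwines
   the actions induced by k |> l and l. Conversely, if l' is not in the orbit of
   l, a function lam vanishing at l' only acts invertibly on the module induced
   by l, whereas in the module induced by l' its image consists of functions
   vanishing at 1.
   For unitarity, a compact group is unimodular (Tonelli), elements of U^(k)
   commute with integration over K, and the involution preserves U^(k) because
   distributions acting on separate variables commute (Schwarz). *)
Set Implicit Arguments.
Unset Strict Implicit.
Unset Printing Implicit Defensive.

Import Order.TTheory GRing.Theory Num.Theory numFieldNormedType.Exports.
Local Open Scope classical_set_scope.
Local Open Scope ring_scope.

(** * Smooth functions on open subsets of Euclidean space *)

(** The regular actions are relations, tested only on the products that stay in H. Everything
    therefore passes through the explicit formula [actH]: it solves the relation, and uniqueness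
    turns each hypothesis about the relation into an equation between functions on K. As [tangent]
    has no controlled value on functions that are not smooth, functionals are compared on smooth
    functions only, and each use of linearity asks for the smoothness of an inner function which is
    itself often obtained by applying a distribution to some of the variables; hence the parameters
    carried along from the start. Unimodularity enters because k acts on kappa by left translation,
    whereas the measure is only assumed right invariant. Schwarz enters because the involution
    reverses convolutions, and with them the order in which two distributions are applied. *)

Lemma near_eq_differentiable (R : realType) (V W : normedModType R)
    (f g : V -> W) (x : V) :
  {near x, f =1 g} -> differentiable f x -> differentiable g x.
Proof.
(* The difference vanishes near [x], so it is o(id) there, with differential 0. *)
move=> fg df; pose h := g - f.
have hE : g = f + h by rewrite /h addrC subrK.
have dh : h \o shift x = cst (h x) + 0 +o_ 0 id.
  apply/eqaddoP => _/posnumP[eps]; near=> y.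
  have hx : h x = 0 by rewrite /h !fctE (nbhs_singleton fg) subrr.
  have hy : h (y + x) = 0.
    have : f (y + x) = g (y + x).
      near: y; move: fg; rewrite {1}(near_shift 0 x) /= subr0.
      exact.
    by rewrite /h !fctE => ->; rewrite subrr.
  by rewrite /= !fctE /= hx hy addr0 subrr normr0 mulr_ge0.
have c0 : continuous (0 : V -> W) by move=> ?; exact: cvg_cst.
rewrite hE; apply: differentiableD => //.
apply/diff_locallyP.
have -> : 'd h x = 0 :> (V -> W) by exact: (diff_unique (df := \0) c0 dh).
by split.
Unshelve. all: by end_near. Qed.


Lemma near_open (T : topologicalType) (U : set T) (P : T -> Prop) (x : T) :
  open U -> (forall y, U y -> P y) -> U x -> \forall y \near x, P y.
Proof. by move=> oU UP Ux; apply: filterS UP _; exact: open_nbhs_nbhs. Qed.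

Section CnOn.
Variable R : realType.

Section General.
Variables (m : nat) (W : normedModType R).
Implicit Types (U V : set 'rV[R]_m) (f g : 'rV[R]_m -> W).

Lemma Cn_on_congr n U f g : open U -> (forall x, U x -> f x = g x) ->
  Cn_on n U f -> Cn_on n U g.
Proof.
move=> oU; elim: n f g => [|n IHn] f g fg /=.
  move=> cf x Ux; rewrite /prop_for /continuous_at -(fg _ Ux).
  apply: cvg_trans (cf x Ux); apply: (@near_eq_cvg _ _ (nbhs x) _ f g).
  exact: near_open oU fg Ux.
move=> [df Df]; split=> [x Ux|v].
  by apply: near_eq_differentiable (df x Ux); exact: near_open oU fg Ux.
apply: IHn (Df v) => x Ux; apply: near_eq_derive; exact: near_open oU fg Ux.
Qed.

Lemma Cn_on_sub n U V f : V `<=` U -> Cn_on n U f -> Cn_on n V f.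
Proof.
move=> VU; elim: n f => [|n IHn] f /=; first by move=> cf x /VU/cf.
by move=> [df Df]; split=> [x /VU/df|v]; last exact: IHn.
Qed.

(** Derivatives are taken in the ambient space, so every clause of [Cn_on] is a condition at single
    points of [U]; singletons are legitimate here although they are not open. *)
Lemma Cn_onP n U f : (forall x, U x -> Cn_on n [set x] f) -> Cn_on n U f.
Proof.
elim: n f => [|n IHn] f /= H; first by move=> x Ux; exact: (H x Ux).
split=> [x Ux|v]; first by have [d _] := H x Ux; exact: d.
by apply: IHn => x Ux; have [_ /(_ v)] := H x Ux.
Qed.

Lemma Cn_onW n U f : Cn_on n.+1 U f -> Cn_on n U f.
Proof.
elim: n f => [|n IHn] f /=.
  by move=> [df _] x Ux; apply: differentiable_continuous; exact: df.
by move=> [df Df]; split=> // v; exact/IHn/Df.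
Qed.

Lemma Cn_on_cst n U (a : W) : Cn_on n U (cst a).
Proof.
elim: n a => [|n IHn] a /=; first by move=> x _; exact: cst_continuous.
split=> [x _|v]; first exact: differentiable_cst.
rewrite (_ : 'D_v (cst a) = cst 0); last first.
  by apply/funext => x; rewrite /= derive_cst.
exact: IHn.
Qed.

Lemma Cn_on_linear n U (f : {linear 'rV[R]_m -> W}) : continuous f ->
  Cn_on n U f.
Proof.
move=> cf; case: n => [|n] /=; first by move=> x _; exact: cf.
split=> [x _|v]; first exact: linear_differentiable.
rewrite (_ : 'D_v f = cst (f v)); first exact: Cn_on_cst.
apply/funext => x /=; rewrite deriveE; last exact: linear_differentiable.
by rewrite diff_lin.
Qed.

Lemma Cn_onD n U f g : open U -> Cn_on n U f -> Cn_on n U g ->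
  Cn_on n U (fun x => f x + g x).
Proof.
move=> oU; elim: n f g => [|n IHn] f g /=.
  by move=> cf cg x Ux; apply: continuousD; [exact: (cf x Ux)|exact: (cg x Ux)].
move=> [df Df] [dg Dg]; split=> [x Ux|v].
  by apply: differentiableD; [exact: df|exact: dg].
apply: Cn_on_congr oU _ (IHn _ _ (Df v) (Dg v)) => x Ux /=.
by rewrite -deriveD //; apply: diff_derivable; [exact: df|exact: dg].
Qed.

Lemma Cn_on_sum n U (I : Type) (s : seq I) (F : I -> 'rV[R]_m -> W) :
  open U -> (forall i, Cn_on n U (F i)) ->
  Cn_on n U (fun x => \sum_(i <- s) F i x).
Proof.
move=> oU HF; elim: s => [|i s IHs].
  by under [X in Cn_on _ _ X]eq_fun do rewrite big_nil; exact: Cn_on_cst.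
under [X in Cn_on _ _ X]eq_fun do rewrite big_cons.
exact: Cn_onD oU (HF i) IHs.
Qed.

End General.

Section Real.
Variable m : nat.
Implicit Types (U : set 'rV[R]_m) (f g : 'rV[R]_m -> R^o).

Lemma Cn_onM n U f g : open U -> Cn_on n U f -> Cn_on n U g ->
  Cn_on n U (fun x => f x * g x : R^o).
Proof.
move=> oU; elim: n f g => [|n IHn] f g /=.
  by move=> cf cg x Ux; apply: continuousM; [exact: (cf x Ux)|exact: (cg x Ux)].
move=> /[dup] /Cn_onW Cf [df Df] /[dup] /Cn_onW Cg [dg Dg]; split=> [x Ux|v].
  by apply: (@differentiableM _ _ f g); [exact: df|exact: dg].
apply: (Cn_on_congr (f := fun x => f x * 'D_v g x + g x * 'D_v f x : R^o)) => //.
  move=> x Ux.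
  by rewrite -(@deriveM _ _ f g) //; apply: diff_derivable; [exact: df|exact: dg].
by apply: Cn_onD => //; exact: IHn.
Qed.

Lemma Cn_onV n U f : open U -> (forall x, U x -> f x != 0) -> Cn_on n U f ->
  Cn_on n U (fun x => (f x)^-1 : R^o).
Proof.
move=> oU f0; elim: n f f0 => [|n IHn] f f0.
  by move=> cf x Ux; apply: continuousV; [exact: f0|exact: (cf x Ux)].
move=> /[dup] /Cn_onW Cf /= [df Df]; split=> [x Ux|v].
  by apply: (@differentiableV _ _ f); [exact: df|exact: f0].
apply: (Cn_on_congr (f := fun x => (-1 : R^o) * ((f x)^-1 * (f x)^-1 * 'D_v f x))) => //.
  move=> x Ux.
  rewrite (@deriveV _ _ f) ?f0 //; last by apply: diff_derivable; exact: df.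
  by rewrite mulN1r -exprVn expr2 -mulNr.
apply: Cn_onM (Cn_on_cst _ _ _) _ => //.
apply: Cn_onM => //.
by apply: Cn_onM => //; exact: IHn.
Qed.

End Real.

Lemma Cn_on_coord m k n (U : set 'rV[R]_m) (f : 'rV[R]_m -> 'rV[R]_k) i :
  open U -> Cn_on n U f -> Cn_on n U (fun x => f x 0 i : R^o).
Proof.
move=> oU; elim: n f => [|n IHn] f.
  move=> cf x Ux; apply: (@continuous_comp _ _ _ f (fun M => M 0 i : R)).
    exact: (cf x Ux).
  exact: coord_continuous.
move=> /= [df Df]; split=> [x Ux|v].
  apply: (@differentiable_comp _ _ _ _ f (fun M => M 0 i : R^o)).
    exact: df.
  exact: differentiable_coord.
apply: Cn_on_congr oU _ (IHn _ (Df v)) => x Ux /=.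
by rewrite derive_mx ?mxE //; apply: diff_derivable; exact: df.
Qed.

Lemma Cn_on_mx m k n (U : set 'rV[R]_m) (f : 'rV[R]_m -> 'rV[R]_k) :
  open U -> (forall i, Cn_on n U (fun x => f x 0 i : R^o)) -> Cn_on n U f.
Proof.
move=> oU.
have fE (g : 'rV[R]_m -> 'rV[R]_k) : g = \sum_i (fun x => g x 0 i *: delta_mx 0 i).
  by apply/funext => x; rewrite fct_sumE {1}[g x]row_sum_delta.
elim: n f => [|n IHn] f Hf.
  rewrite (fE f) (_ : \sum_i _ = fun x => \sum_i (f x 0 i *: delta_mx 0 i : 'rV[R]_k)); last first.
    by apply/funext => x; rewrite fct_sumE.
  apply: Cn_on_sum => // i x Ux; apply: continuousZr_tmp; exact: (Hf i x Ux).
have df x : U x -> differentiable f x.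
  move=> Ux; rewrite (fE f); apply: differentiable_sum => i.
  apply: (@differentiableZl _ _ _ (fun x => f x 0 i)).
  by have [+ _] := Hf i; exact.
split=> // v; apply: IHn => i; have [_ /(_ v) Hi] := Hf i.
apply: Cn_on_congr oU _ Hi => x Ux.
by rewrite derive_mx ?mxE //; apply: diff_derivable; exact: df.
Qed.

Lemma derive_comp_rV m k (f : 'rV[R]_m -> 'rV[R]_k) (g : 'rV[R]_k -> R^o) x v :
  differentiable f x -> differentiable g (f x) ->
  'D_v (g \o f) x = \sum_i 'D_v f x 0 i * 'D_(delta_mx 0 i) g (f x).
Proof.
move=> df dg; rewrite deriveE; last exact: differentiable_comp.
rewrite diff_comp //= -(deriveE v df); set w := 'D_v f x.
rewrite {1}(row_sum_delta w) linear_sum.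
by apply: eq_bigr => i _; rewrite linearZ deriveE.
Qed.

(** By the chain rule a derivative of [g \o f] is a combination of partial derivatives of [g]
    composed with [f], so the induction runs over all [g] with [f] fixed. *)
Lemma Cn_on_comp m k n (U : set 'rV[R]_m) (V : set 'rV[R]_k)
    (f : 'rV[R]_m -> 'rV[R]_k) (g : 'rV[R]_k -> R^o) :
  open U -> (forall x, U x -> V (f x)) ->
  Cn_on n U f -> Cn_on n V g -> Cn_on n U (g \o f).
Proof.
move=> oU UV; elim: n g => [|n IHn] g.
  by move=> cf cg x Ux; apply: continuous_comp; [exact: (cf x Ux)|exact: (cg _ (UV _ Ux))].
move=> /[dup] /Cn_onW Cf /= [df Df] [dg Dg]; split=> [x Ux|v].
  by apply: differentiable_comp; [exact: df|exact/dg/UV].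
apply: (Cn_on_congr (f := fun x => \sum_i 'D_v f x 0 i * ('D_(delta_mx 0 i) g \o f) x : R^o)) => //.
  by move=> x Ux; rewrite derive_comp_rV //; [exact: df|exact/dg/UV].
apply: Cn_on_sum => // i; apply: Cn_onM => //; first exact: Cn_on_coord.
exact: IHn.
Qed.

End CnOn.

Section SmoothOn.
Variable R : realType.

Lemma smooth_on_congr m (W : normedModType R) (U : set 'rV[R]_m)
    (f g : 'rV[R]_m -> W) : open U -> (forall x, U x -> f x = g x) ->
  smooth_on U f -> smooth_on U g.
Proof. by move=> oU fg sf n; exact: Cn_on_congr oU fg (sf n). Qed.

Lemma smooth_on_sub m (W : normedModType R) (U V : set 'rV[R]_m)
    (f : 'rV[R]_m -> W) : V `<=` U -> smooth_on U f -> smooth_on V f.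
Proof. by move=> VU sf n; exact: Cn_on_sub VU (sf n). Qed.

Lemma smooth_on_local m (W : normedModType R) (U : set 'rV[R]_m)
    (f : 'rV[R]_m -> W) :
  (forall x, U x -> exists V, [/\ open V, V x & smooth_on V f]) ->
  smooth_on U f.
Proof.
move=> H n; apply: Cn_onP => x /H[V [_ Vx sV]].
by apply: Cn_on_sub (sV n) => y ->.
Qed.

Lemma smooth_on_continuous m (W : normedModType R) (U : set 'rV[R]_m)
    (f : 'rV[R]_m -> W) x : smooth_on U f -> U x -> {for x, continuous f}.
Proof. by move=> sf Ux; exact: (sf 0%N x Ux). Qed.

Lemma smooth_on_differentiable m (W : normedModType R) (U : set 'rV[R]_m)
    (f : 'rV[R]_m -> W) x : smooth_on U f -> U x -> differentiable f x.
Proof. by move=> sf Ux; have [+ _] := sf 1%N; exact. Qed.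

Lemma smooth_on_derive m (W : normedModType R) (U : set 'rV[R]_m)
    (f : 'rV[R]_m -> W) v : smooth_on U f -> smooth_on U ('D_v f).
Proof. by move=> sf n; have [_] := sf n.+1; exact. Qed.

Lemma smooth_on_cst m (W : normedModType R) (U : set 'rV[R]_m) (a : W) :
  smooth_on U (fun=> a).
Proof. by move=> n; exact: Cn_on_cst. Qed.

Lemma smooth_on_linear m (W : normedModType R) (U : set 'rV[R]_m)
    (f : {linear 'rV[R]_m -> W}) : continuous f -> smooth_on U f.
Proof. by move=> cf n; exact: Cn_on_linear. Qed.

Lemma smooth_on_id m (U : set 'rV[R]_m) : smooth_on U id.
Proof. by apply: (@smooth_on_linear _ _ _ idfun) => x. Qed.

Lemma smooth_onD m (W : normedModType R) (U : set 'rV[R]_m)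
    (f g : 'rV[R]_m -> W) : open U -> smooth_on U f -> smooth_on U g ->
  smooth_on U (fun x => f x + g x).
Proof. by move=> oU sf sg n; exact: Cn_onD. Qed.

Lemma smooth_on_sum m (W : normedModType R) (U : set 'rV[R]_m) (I : Type)
    (s : seq I) (F : I -> 'rV[R]_m -> W) :
  open U -> (forall i, smooth_on U (F i)) ->
  smooth_on U (fun x => \sum_(i <- s) F i x).
Proof. by move=> oU HF n; apply: Cn_on_sum => // i; exact: HF. Qed.

Lemma smooth_onM m (U : set 'rV[R]_m) (f g : 'rV[R]_m -> R^o) :
  open U -> smooth_on U f -> smooth_on U g ->
  smooth_on U (fun x => f x * g x : R^o).
Proof. by move=> oU sf sg n; exact: Cn_onM. Qed.

Lemma smooth_onN m (U : set 'rV[R]_m) (f : 'rV[R]_m -> R^o) :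
  open U -> smooth_on U f -> smooth_on U (fun x => - f x : R^o).
Proof.
move=> oU sf; apply: (smooth_on_congr (f := fun x => -1 * f x : R^o)) => //.
  by move=> x _; rewrite mulN1r.
by apply: smooth_onM => //; exact: smooth_on_cst.
Qed.

Lemma smooth_onB m (U : set 'rV[R]_m) (f g : 'rV[R]_m -> R^o) :
  open U -> smooth_on U f -> smooth_on U g ->
  smooth_on U (fun x => f x - g x : R^o).
Proof. by move=> oU sf sg; apply: smooth_onD => //; exact: smooth_onN. Qed.

Lemma smooth_onV m (U : set 'rV[R]_m) (f : 'rV[R]_m -> R^o) :
  open U -> (forall x, U x -> f x != 0) -> smooth_on U f ->
  smooth_on U (fun x => (f x)^-1 : R^o).
Proof. by move=> oU f0 sf n; exact: Cn_onV. Qed.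

Lemma smooth_on_coord m k (U : set 'rV[R]_m) (f : 'rV[R]_m -> 'rV[R]_k) i :
  open U -> smooth_on U f -> smooth_on U (fun x => f x 0 i : R^o).
Proof. by move=> oU sf n; exact: Cn_on_coord. Qed.

Lemma smooth_on_mx m k (U : set 'rV[R]_m) (f : 'rV[R]_m -> 'rV[R]_k) :
  open U -> (forall i, smooth_on U (fun x => f x 0 i : R^o)) -> smooth_on U f.
Proof. by move=> oU Hf n; apply: Cn_on_mx => // i; exact: Hf. Qed.

Lemma smooth_on_row_mx m k l (U : set 'rV[R]_m) (f : 'rV[R]_m -> 'rV[R]_k)
    (g : 'rV[R]_m -> 'rV[R]_l) : open U -> smooth_on U f -> smooth_on U g ->
  smooth_on U (fun x => row_mx (f x) (g x)).
Proof.
move=> oU sf sg; apply: smooth_on_mx => // i.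
case: (split_ordP i) => j ->.
  under [X in smooth_on _ X]eq_fun do rewrite row_mxEl.
  exact: smooth_on_coord.
under [X in smooth_on _ X]eq_fun do rewrite row_mxEr.
exact: smooth_on_coord.
Qed.

Lemma smooth_on_comp m k (U : set 'rV[R]_m) (V : set 'rV[R]_k)
    (f : 'rV[R]_m -> 'rV[R]_k) (g : 'rV[R]_k -> R^o) :
  open U -> (forall x, U x -> V (f x)) ->
  smooth_on U f -> smooth_on V g -> smooth_on U (fun x => g (f x)).
Proof. by move=> oU UV sf sg n; exact: Cn_on_comp UV (sf n) (sg n). Qed.

Lemma smooth_on_comp_rV m k l (U : set 'rV[R]_m) (V : set 'rV[R]_k)
    (f : 'rV[R]_m -> 'rV[R]_k) (g : 'rV[R]_k -> 'rV[R]_l) :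
  open U -> open V -> (forall x, U x -> V (f x)) ->
  smooth_on U f -> smooth_on V g -> smooth_on U (fun x => g (f x)).
Proof.
move=> oU oV UV sf sg; apply: smooth_on_mx => // i.
exact: smooth_on_comp UV sf (smooth_on_coord i oV sg).
Qed.

Lemma smooth_on_lsubmx k l (U : set 'rV[R]_(k + l)) :
  smooth_on U (fun x => lsubmx x : 'rV[R]_k).
Proof. by apply: (@smooth_on_linear _ _ _ lsubmx); exact: continuous_lsubmx. Qed.

Lemma smooth_on_rsubmx k l (U : set 'rV[R]_(k + l)) :
  smooth_on U (fun x => rsubmx x : 'rV[R]_l).
Proof. by apply: (@smooth_on_linear _ _ _ rsubmx); exact: continuous_rsubmx. Qed.

(** A directional derivative sees only the restriction to a line. It can thus be compared across
    different source spaces, such as a factor and a product. *)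
Lemma eq_derive_line (V V' W : normedModType R) (f : V -> W) (g : V' -> W)
    a v a' v' : (forall h : R, f (h *: v + a) = g (h *: v' + a')) ->
  'D_v f a = 'D_v' g a'.
Proof.
move=> fg; have fga : f a = g a'.
  by have := fg 0; rewrite !scale0r !add0r.
suff E : (fun h : R => h^-1 *: ((f \o shift a) (h *: v) - f a)) =
         (fun h : R => h^-1 *: ((g \o shift a') (h *: v') - g a')).
  by rewrite /derive E.
by apply/funext => h /=; rewrite fg fga.
Qed.

Lemma derive_lincomb (V : normedModType R) (f g h : V -> R^o) (a b : R) x v :
  derivable f x v -> derivable g x v -> derivable h x v ->
  'D_v (fun y => a * f y + b * g y + h y : R^o) x =
  a * 'D_v f x + b * 'D_v g x + 'D_v h x.
Proof.
move=> df dg dh; have daf := @derivableZ _ _ _ f a x v df.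
have dbg := @derivableZ _ _ _ g b x v dg.
transitivity ('D_v (a \*: f + b \*: g + h) x); first by [].
by rewrite (deriveD (derivableD daf dbg) dh) (deriveD daf dbg) !deriveZ.
Qed.

Lemma derive_row_mx k l (W : normedModType R) (F : 'rV[R]_(k + l) -> W) x y v :
  'D_v (fun z => F (row_mx x z)) y = 'D_(row_mx 0 v) F (row_mx x y).
Proof.
apply: eq_derive_line => h; congr F.
by rewrite scale_row_mx add_row_mx scaler0 add0r.
Qed.

Lemma derive_row_mxl k l (W : normedModType R) (F : 'rV[R]_(k + l) -> W) x y v :
  'D_v (fun z => F (row_mx z y)) x = 'D_(row_mx v 0) F (row_mx x y).
Proof.
apply: eq_derive_line => h; congr F.
by rewrite scale_row_mx add_row_mx scaler0 add0r.
Qed.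

Lemma open_preimage_on (S T : topologicalType) (U : set S) (O : set T)
    (p : S -> T) : open U -> open O ->
  (forall x, U x -> {for x, continuous p}) -> open (U `&` p @^-1` O).
Proof.
move=> oU oO cp; rewrite openE => x [Ux Opx].
apply: filterI; first exact: open_nbhs_nbhs.
by apply: (cp x Ux); exact: open_nbhs_nbhs.
Qed.

Definition csmooth_on m (U : set 'rV[R]_m) (f : 'rV[R]_m -> R[i]) : Prop :=
  smooth_on U (fun x => complex.Re (f x) : R^o) /\
  smooth_on U (fun x => complex.Im (f x) : R^o).

Lemma csmooth_on_congr m (U : set 'rV[R]_m) f g : open U ->
  (forall x, U x -> f x = g x) -> csmooth_on U f -> csmooth_on U g.
Proof.
move=> oU fg [sf sf']; split.
  by apply: smooth_on_congr oU _ sf => x /fg ->.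
by apply: smooth_on_congr oU _ sf' => x /fg ->.
Qed.

Lemma csmooth_on_local m (U : set 'rV[R]_m) f :
  (forall x, U x -> exists V, [/\ open V, V x & csmooth_on V f]) ->
  csmooth_on U f.
Proof.
move=> H; split; apply: smooth_on_local => x /H[V [oV Vx [sf sf']]].
  by exists V.
by exists V.
Qed.

Lemma csmooth_on_cst m (U : set 'rV[R]_m) a : csmooth_on U (fun=> a).
Proof. by split; exact: smooth_on_cst. Qed.

Lemma csmooth_onD m (U : set 'rV[R]_m) f g : open U ->
  csmooth_on U f -> csmooth_on U g -> csmooth_on U (fun x => f x + g x).
Proof.
move=> oU [sf sf'] [sg sg']; split.
  under [X in smooth_on _ X]eq_fun do rewrite raddfD; exact: smooth_onD.
under [X in smooth_on _ X]eq_fun do rewrite raddfD; exact: smooth_onD.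
Qed.

Lemma Re_cadd (x y : R[i]) : complex.Re (x + y) = complex.Re x + complex.Re y.
Proof. by case: x y => [a b] [c d]. Qed.

Lemma Im_cadd (x y : R[i]) : complex.Im (x + y) = complex.Im x + complex.Im y.
Proof. by case: x y => [a b] [c d]. Qed.

Lemma Re_cmul (x y : R[i]) : complex.Re (x * y) =
  complex.Re x * complex.Re y - complex.Im x * complex.Im y.
Proof. by case: x y => [a b] [c d]. Qed.

Lemma Im_cmul (x y : R[i]) : complex.Im (x * y) =
  complex.Re x * complex.Im y + complex.Im x * complex.Re y.
Proof. by case: x y => [a b] [c d]. Qed.

Lemma csmooth_onM m (U : set 'rV[R]_m) f g : open U ->
  csmooth_on U f -> csmooth_on U g -> csmooth_on U (fun x => f x * g x).
Proof.
move=> oU [sf sf'] [sg sg']; split.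
  under [X in smooth_on _ X]eq_fun do rewrite Re_cmul.
  by apply: smooth_onB => //; exact: smooth_onM.
under [X in smooth_on _ X]eq_fun do rewrite Im_cmul.
by apply: smooth_onD => //; exact: smooth_onM.
Qed.

Lemma csmooth_on_conj m (U : set 'rV[R]_m) f : open U ->
  csmooth_on U f -> csmooth_on U (fun x => conjc (f x)).
Proof.
move=> oU [sf sf']; split.
  by apply: smooth_on_congr oU _ sf => x _; case: (f x).
apply: (smooth_on_congr oU _ (smooth_onN oU sf')) => x _.
by case: (f x).
Qed.

Lemma Re_mul_conjc_neq0 (z : R[i]) : z != 0 -> complex.Re (z * conjc z) != 0.
Proof.
case: z => a b; rewrite eq_complex /= mulrN opprK -!expr2 paddr_eq0 ?sqr_ge0 //.
by rewrite !sqrf_eq0.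
Qed.

(** Reduces the complex inverse to a real one, whose smoothness is known. *)
Lemma invc_conjc (z : R[i]) : z != 0 ->
  z^-1 = conjc z * Complex (complex.Re (z * conjc z))^-1 0.
Proof.
move=> z0; have N0 := Re_mul_conjc_neq0 z0.
apply: (mulfI z0); rewrite divff // mulrA.
move: N0; case: z z0 => a b _ /= N0; apply/eqP; rewrite eq_complex /=.
rewrite !mulr0 subr0 add0r mulfV // eqxx /=.
by rewrite mulrN (mulrC b a) addNr mul0r.
Qed.

Lemma csmooth_onV m (U : set 'rV[R]_m) (f : 'rV[R]_m -> R[i]) : open U ->
  (forall x, U x -> f x != 0) -> csmooth_on U f -> csmooth_on U (fun x => (f x)^-1).
Proof.
move=> oU f0 sf; have sfb := csmooth_on_conj oU sf.
have [sn _] := csmooth_onM oU sf sfb.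
apply: (csmooth_on_congr (f := fun x => conjc (f x) *
    Complex (complex.Re (f x * conjc (f x)))^-1 0)) => //.
  by move=> x /f0 /invc_conjc ->.
apply: csmooth_onM => //; split; last exact: smooth_on_cst.
by apply: smooth_onV => // x /f0; exact: Re_mul_conjc_neq0.
Qed.

Lemma csmooth_on_sum m (U : set 'rV[R]_m) (I : Type) (s : seq I) F : open U ->
  (forall i, csmooth_on U (F i)) ->
  csmooth_on U (fun x => \sum_(i <- s) F i x).
Proof.
move=> oU HF; elim: s => [|i s IHs].
  by under [X in csmooth_on _ X]eq_fun do rewrite big_nil; exact: csmooth_on_cst.
under [X in csmooth_on _ X]eq_fun do rewrite big_cons.
exact: csmooth_onD.
Qed.

Lemma csmooth_on_comp m k (U : set 'rV[R]_m) (V : set 'rV[R]_k) s f :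
  open U -> (forall x, U x -> V (s x)) ->
  smooth_on U s -> csmooth_on V f -> csmooth_on U (fun x => f (s x)).
Proof.
move=> oU UV ss [sf sf']; split; first exact: smooth_on_comp UV ss sf.
exact: smooth_on_comp UV ss sf'.
Qed.

End SmoothOn.

(** * Plots on manifolds *)

Section Plots.
Variable R : realType.

(* Maps from open subsets of Euclidean spaces test smoothness on manifolds
   without products of manifolds. *)
Definition plot (M : topologicalType) k (A : set (chart R M k)) m
    (U : set 'rV[R]_m) (p : 'rV[R]_m -> M) : Prop :=
  (forall x, U x -> {for x, continuous p}) /\
  (forall d, A d -> smooth_on (U `&` p @^-1` chart_dom d) (fun x => d (p x))).

(** [smooth_atlas] without the transition maps: easily verified for a product atlas, and enough for
    smooth maps to send plots to plots. *)
Definition chart_cover (M : topologicalType) k (A : set (chart R M k)) :=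
  (forall c, A c ->
    [/\ open (chart_dom c), open (chart_cod c),
        forall x, chart_dom c x -> chart_inv c (c x) = x &
        forall y, chart_cod c y -> {for y, continuous (chart_inv c)}]) /\
  (forall x, exists2 c, A c & chart_dom c x).

Lemma smooth_atlas_cover (M : topologicalType) k (A : set (chart R M k)) :
  smooth_atlas A -> chart_cover A.
Proof. by case=> HA cA _; split=> // c /HA[]. Qed.

Lemma prod_chart_cod (M N : Type) k l (c : chart R M k) (d : chart R N l) :
  chart_cod (prod_chart c d) =
  (setT `&` lsubmx @^-1` chart_cod c) `&` (setT `&` rsubmx @^-1` chart_cod d).
Proof.
apply/seteqP; split=> [_ [[x y] [/= cx dy] <-]|z [[_ [x cx cxz]] [_ [y dy dyz]]]].
  by split; split=> //=; rewrite ?row_mxKl ?row_mxKr; [exists x|exists y].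
by exists (x, y) => //=; rewrite cxz dyz hsubmxK.
Qed.

Lemma prod_atlas_cover (M N : topologicalType) k l (A : set (chart R M k))
    (B : set (chart R N l)) :
  chart_cover A -> chart_cover B -> chart_cover (prod_atlas A B).
Proof.
move=> [HA cA] [HB cB]; split.
  move=> _ [c [d [/HA[oc oc' ic cc] /HB[od od' id' cd] ->]]]; split.
  - rewrite openE => -[x y] [/= cx dy].
    by exists (chart_dom c, chart_dom d) => //; split; exact: open_nbhs_nbhs.
  - rewrite prod_chart_cod; apply: openI.
      apply: (open_preimage_on openT oc') => z _; exact: continuous_lsubmx.
    apply: (open_preimage_on openT od') => z _; exact: continuous_rsubmx.
  - by move=> [x y] [/= cx dy]; rewrite row_mxKl row_mxKr ic ?id'.
  - move=> z; rewrite prod_chart_cod => -[[_ cz] [_ dz]].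
    have c1 : {for z, continuous (chart_inv c \o lsubmx)}.
      by apply: continuous_comp; [exact: continuous_lsubmx|exact: cc].
    have c2 : {for z, continuous (chart_inv d \o rsubmx)}.
      by apply: continuous_comp; [exact: continuous_rsubmx|exact: cd].
    exact: (cvg_pair c1 c2).
move=> [x y]; have [c Ac cx] := cA x; have [d Bd dy] := cB y.
by exists (prod_chart c d) => //; exists c, d.
Qed.

Lemma plot_sub (M : topologicalType) k (A : set (chart R M k)) m
    (U V : set 'rV[R]_m) p : V `<=` U -> plot A U p -> plot A V p.
Proof.
move=> VU [cp sp]; split=> [x /VU/cp//|d Ad].
by apply: smooth_on_sub (sp d Ad) => x [/VU].
Qed.

Lemma plot_cst (M : topologicalType) k (A : set (chart R M k)) m
    (U : set 'rV[R]_m) a : plot A U (fun=> a).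
Proof.
split=> [x _|d _]; first exact: cst_continuous.
exact: smooth_on_cst.
Qed.

(** The compatibility of charts enters here; afterwards it is seen only through plots. *)
Lemma plot_chart_inv (M : topologicalType) k (A : set (chart R M k)) c :
  smooth_atlas A -> A c -> plot A (chart_cod c) (chart_inv c).
Proof.
move=> [HA _ sA] Ac; have [_ _ ic _ cc] := HA c Ac.
split=> // d Ad; apply: smooth_on_sub (sA c d Ac Ad).
by move=> _ [[x cx <-] /=]; rewrite ic // => dx; exists x.
Qed.

Lemma plot_comp (M : topologicalType) k (A : set (chart R M k)) m n
    (U : set 'rV[R]_m) (V : set 'rV[R]_n) p s : chart_cover A ->
  open U -> open V -> (forall x, V x -> U (s x)) ->
  smooth_on V s -> plot A U p -> plot A V (fun x => p (s x)).
Proof.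
move=> [HA _] oU oV VU ss [cp sp].
have cps x : V x -> {for x, continuous (p \o s)}.
  move=> Vx; apply: continuous_comp; first exact: smooth_on_continuous ss Vx.
  exact/cp/VU.
split=> // d Ad.
have oW : open (V `&` (p \o s) @^-1` chart_dom d).
  by apply: open_preimage_on => //; have [] := HA d Ad.
have oW' : open (U `&` p @^-1` chart_dom d).
  by apply: open_preimage_on => //; have [] := HA d Ad.
apply: smooth_on_comp_rV oW oW' _ _ (sp d Ad).
  by move=> x [Vx dx]; split => //; exact: VU.
by apply: smooth_on_sub ss => x [].
Qed.

Lemma plot_pair (M N : topologicalType) k l (A : set (chart R M k))
    (B : set (chart R N l)) m (U : set 'rV[R]_m) p q :
  chart_cover A -> chart_cover B -> open U ->
  plot A U p -> plot B U q -> plot (prod_atlas A B) U (fun x => (p x, q x)).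
Proof.
move=> [HA _] [HB _] oU [cp sp] [cq sq].
split=> [x Ux|_ [c [d [Ac Bd ->]]]].
  exact: (cvg_pair (cp x Ux) (cq x Ux)).
have oW : open (U `&` (fun x => (p x, q x)) @^-1` (chart_dom c `*` chart_dom d)).
  rewrite (_ : _ `&` _ = (U `&` p @^-1` chart_dom c) `&`
                         (U `&` q @^-1` chart_dom d)); last first.
    by apply/seteqP; split=> x /=; [case=> ? []|case=> -[? ?] []].
  by apply: openI; apply: open_preimage_on => //; [have [] := HA c Ac|have [] := HB d Bd].
apply: smooth_on_row_mx => //.
  by apply: smooth_on_sub (sp c Ac) => x [? []].
by apply: smooth_on_sub (sq d Bd) => x [? []].
Qed.

Lemma plot_map (M N : topologicalType) k l (A : set (chart R M k))
    (B : set (chart R N l)) (D : set M) (f : M -> N) m (U : set 'rV[R]_m) p :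
  chart_cover A -> chart_cover B -> open D -> smooth_map A B D f ->
  open U -> plot A U p -> (forall x, U x -> D (p x)) -> plot B U (fun x => f (p x)).
Proof.
move=> [HA cA] [HB _] oD [cf sf] oU [cp sp] UD.
have cfp x : U x -> {for x, continuous (f \o p)}.
  by move=> Ux; apply: continuous_comp; [exact: cp|exact/cf/UD].
split=> // e Be; have [oe _ _ _] := HB e Be.
apply: smooth_on_local => x [Ux ex]; have [c Ac cx] := cA (p x).
have [oc oc' ic cc] := HA c Ac.
pose V := (U `&` p @^-1` chart_dom c) `&` (U `&` (f \o p) @^-1` chart_dom e).
have oV : open V by apply: openI; exact: open_preimage_on.
exists V; split=> //.
(* Inserting the chart [c] between [p] and [f] leaves a composition of maps between Euclidean
   spaces. *)
apply: (smooth_on_congr (f := fun y => (e \o f \o chart_inv c) (c (p y)))) => //.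
  by move=> y [[Uy cy] _] /=; rewrite ic.
pose O := (chart_dom c `&` D) `&` f @^-1` chart_dom e.
have oO : open O.
  have -> : O = chart_dom c `&` (D `&` f @^-1` chart_dom e) by rewrite /O setIA.
  exact: openI oc (open_preimage_on oD oe cf).
(* The composition lemma needs an open intermediate domain; the image under [c] is rewritten as a
   preimage under the continuous [chart_inv c]. *)
have oS : open (c @` O).
  rewrite (_ : c @` O = chart_cod c `&` chart_inv c @^-1` O).
    exact: open_preimage_on oc' oO cc.
  apply/seteqP; split=> [_ [y [[cy Dy] ey] <-]|_ [[y cy <-]]].
    by split; [exists y|rewrite /= ic].
  by rewrite /= ic // => Oy; exists y.
have sc : smooth_on V (fun x => c (p x)).
  by apply: smooth_on_sub (sp c Ac) => y [].
apply: (smooth_on_comp_rV oV oS _ sc (sf c e Ac Be)).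
by move=> y [[Uy cy] [_ ey]]; exists (p y) => //; split=> //; split=> //; exact: UD.
Qed.

End Plots.

(** * Plots and distributions on Lie groups *)

Section LiePlots.
Variables (R : realType) (G : lieGroup R).
Local Notation C := R[i].

Definition gplot m (U : set 'rV[R]_m) (p : 'rV[R]_m -> G) := plot (@lie_atlas _ G) U p.

Lemma lie_cover : chart_cover (@lie_atlas _ G).
Proof. exact: smooth_atlas_cover (lie_atlasP G). Qed.

Lemma gplot_comp m n (U : set 'rV[R]_m) (V : set 'rV[R]_n) p s :
  open U -> open V -> (forall x, V x -> U (s x)) ->
  smooth_on V s -> gplot U p -> gplot V (fun x => p (s x)).
Proof. exact: plot_comp lie_cover. Qed.

Lemma gplotM m (U : set 'rV[R]_m) p q : open U -> gplot U p -> gplot U q ->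
  gplot U (fun x => (p x * q x)%g).
Proof.
move=> oU gp gq; have gpq := plot_pair lie_cover lie_cover oU gp gq.
exact: (plot_map (prod_atlas_cover lie_cover lie_cover) lie_cover openT
  (lie_mul_smooth G) oU gpq).
Qed.

Lemma gplotV m (U : set 'rV[R]_m) p : open U -> gplot U p ->
  gplot U (fun x => (p x)^-1%g).
Proof.
move=> oU gp; exact: (plot_map lie_cover lie_cover openT (lie_inv_smooth G) oU gp).
Qed.

Lemma gplot_chart c : lie_atlas c -> gplot (chart_cod c) (chart_inv c : _ -> G).
Proof. exact: plot_chart_inv (lie_atlasP G). Qed.

Lemma chart_cod_open c : @lie_atlas _ G c -> open (chart_cod c).
Proof. by move=> Ac; have [/(_ c Ac)[]] := lie_atlasP G. Qed.

Lemma smoothC_plot m (U : set 'rV[R]_m) (p : 'rV[R]_m -> G) (f : G -> C) :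
  open U -> gplot U p -> smoothC f -> csmooth_on U (fun x => f (p x)).
Proof.
move=> oU [cp sp] sf; apply: csmooth_on_local => x Ux.
have [HA cA] := lie_cover; have [c Ac cx] := cA (p x).
have [oc oc' ic _] := HA c Ac.
pose V := U `&` p @^-1` chart_dom c.
have oV : open V by exact: open_preimage_on oU oc cp.
exists V; split=> //.
have fE y : V y -> f (chart_inv c (c (p y))) = f (p y) by move=> [_ cy]; rewrite ic.
apply: (csmooth_on_congr oV fE).
have [s1 s2] := sf c Ac.
apply: (csmooth_on_comp (V := chart_cod c) (f := f \o chart_inv c) oV _ (sp c Ac)) => //.
by move=> y [_ cy]; exists (p y).
Qed.

Lemma smoothCP (f : G -> C) :
  (forall (U : set 'rV[R]_(lie_dim G)) p, open U -> gplot U p ->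
     csmooth_on U (fun x => f (p x))) -> smoothC f.
Proof.
move=> H c Ac.
exact: H (chart_cod_open Ac) (gplot_chart Ac).
Qed.

Lemma smoothC_cst (a : C) : @smoothC R G (fun=> a).
Proof. by apply: smoothCP => U p _ _; exact: csmooth_on_cst. Qed.

Lemma smoothCD (f g : G -> C) : smoothC f -> smoothC g ->
  smoothC (fun x => f x + g x).
Proof.
by move=> sf sg; apply: smoothCP => U p oU gp; apply: csmooth_onD => //; exact: smoothC_plot.
Qed.

Lemma smoothCM (f g : G -> C) : smoothC f -> smoothC g ->
  smoothC (fun x => f x * g x).
Proof.
by move=> sf sg; apply: smoothCP => U p oU gp; apply: csmooth_onM => //; exact: smoothC_plot.
Qed.

Lemma smoothCZ (a : C) (f : G -> C) : smoothC f -> smoothC (fun x => a * f x).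
Proof. by move=> sf; apply: smoothCM => //; exact: smoothC_cst. Qed.

Lemma smoothC_conj (f : G -> C) : smoothC f -> smoothC (fun x => conjc (f x)).
Proof.
by move=> sf; apply: smoothCP => U p oU gp; apply: csmooth_on_conj => //; exact: smoothC_plot.
Qed.

Lemma smoothC_sum (I : Type) (s : seq I) (F : I -> G -> C) :
  (forall i, smoothC (F i)) -> smoothC (fun x => \sum_(i <- s) F i x).
Proof.
move=> sF; apply: smoothCP => U p oU gp.
by apply: csmooth_on_sum => // i; exact: smoothC_plot.
Qed.

Lemma smoothC_mulr (f : G -> C) k : smoothC f -> smoothC (fun x => f (x * k)%g).
Proof.
move=> sf; apply: smoothCP => U p oU gp; apply: smoothC_plot => //.
by apply: gplotM => //; exact: plot_cst.
Qed.

Lemma smoothC_mull (f : G -> C) k : smoothC f -> smoothC (fun x => f (k * x)%g).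
Proof.
move=> sf; apply: smoothCP => U p oU gp; apply: smoothC_plot => //.
by apply: gplotM => //; exact: plot_cst.
Qed.

Lemma smoothC_inv (f : G -> C) : smoothC f -> smoothC (fun x => f x^-1%g).
Proof.
move=> sf; apply: smoothCP => U p oU gp; apply: smoothC_plot => //.
exact: gplotV.
Qed.

Lemma smoothC_continuous (f : G -> C) : smoothC f ->
  continuous (fun x => complex.Re (f x)) /\ continuous (fun x => complex.Im (f x)).
Proof.
move=> sf; have [HA _ _] := lie_atlasP G; have [_ cA] := lie_cover.
have H (h : C -> R) : (forall c, @lie_atlas _ G c ->
    smooth_on (chart_cod c) ((fun x => h (f x) : R^o) \o chart_inv c)) ->
    continuous (fun x => h (f x)).
  move=> sh x; have [c Ac cx] := cA x; have [oc oc' ic cc _] := HA c Ac.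
  have hE : \forall y \near x, ((fun x => h (f x)) \o chart_inv c) (c y) = h (f y).
    by apply: near_open oc _ cx => y cy /=; rewrite ic.
  rewrite /continuous_at -(nbhs_singleton hE).
  apply: cvg_trans; first by apply: near_eq_cvg; exact: hE.
  apply: (@continuous_comp _ _ _ c ((fun x => h (f x)) \o chart_inv c)).
    exact: cc.
  by apply: smooth_on_continuous (sh c Ac) _; exists x.
by split; apply: H => c Ac; have [] := sf c Ac.
Qed.

(* Joint smoothness of F on U x G, tested on plots. *)
Definition sfam m (U : set 'rV[R]_m) (F : 'rV[R]_m -> G -> C) : Prop :=
  forall k (V : set 'rV[R]_k) s q, open V -> (forall y, V y -> U (s y)) ->
    smooth_on V s -> gplot V q -> csmooth_on V (fun y => F (s y) (q y)).

(** In the convolution case the argument of [v] has one more parameter, the group element fed to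
    [u]. As [sfam] ranges over parameter sets of every dimension, the induction hypothesis for [v]
    absorbs it. *)
Lemma inU_sfam (u : functional G) m (U : set 'rV[R]_m) F :
  inU u -> open U -> sfam U F -> csmooth_on U (fun x => u (F x)).
Proof.
move=> uU; elim: uU m U F => {u} [g|c v Ac c1|a u v _ IHu _ IHv|u v _ IHu _ IHv] m U F oU sF.
- apply: sF => //; first exact: smooth_on_id.
  exact: plot_cst.
- pose W := (setT `&` lsubmx @^-1` U) `&` (setT `&` rsubmx @^-1` chart_cod c).
  have oW : @open 'rV[R]_(m + lie_dim G) W.
    apply: openI.
      apply: (open_preimage_on openT oU) => z _; exact: continuous_lsubmx.
    apply: (open_preimage_on openT (chart_cod_open Ac)) => z _.
    exact: continuous_rsubmx.
  (* The family read in the chart, as one function of the parameter and the coordinates. A tangent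
     vector applied to [F x] becomes a directional derivative of [Phi], which is again smooth in
     both. *)
  pose Phi z := F (lsubmx z : 'rV[R]_m) (chart_inv c (rsubmx z)).
  have sPhi : csmooth_on W Phi.
    apply: sF => //.
    + by move=> z [[_ ?] _].
    + exact: smooth_on_lsubmx.
    + apply: gplot_comp (chart_cod_open Ac) oW _ _ (gplot_chart Ac).
        by move=> z [_ [_ ?]].
      exact: smooth_on_rsubmx.
  have sr : smooth_on U (fun x => row_mx x (c 1%g)).
    by apply: smooth_on_row_mx => //; [exact: smooth_on_id|exact: smooth_on_cst].
  have UW x : U x -> W (row_mx x (c 1%g)).
    by move=> Ux; split; split=> //=; rewrite ?row_mxKl ?row_mxKr //; exists 1%g.
  have PhiE x : F x \o chart_inv c = fun y => Phi (row_mx x y).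
    by apply/funext => y; rewrite /Phi row_mxKl row_mxKr.
  have H (h : C -> R^o) : smooth_on W (fun z => h (Phi z)) ->
    smooth_on U (fun x => 'D_v ((fun y => h (F x y)) \o chart_inv c) (c 1%g) : R^o).
    move=> sh.
    have E x : 'D_v ((fun y => h (F x y)) \o chart_inv c) (c 1%g) =
       'D_(row_mx 0 v) (fun z => h (Phi z)) (row_mx x (c 1%g)).
      rewrite -derive_row_mx; congr ('D_v _ _).
      by apply/funext => y; rewrite /Phi row_mxKl row_mxKr.
    under [X in smooth_on _ X]eq_fun do rewrite E.
    exact: smooth_on_comp oU UW sr (smooth_on_derive _ sh).
  by case: sPhi => s1 s2; split; exact: H.
- apply: csmooth_onD => //; last exact: IHv.
  by apply: csmooth_onM => //; [exact: csmooth_on_cst|exact: IHu].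
- apply: IHu => // k V s q oV VU ss gq.
  apply: IHv => // k' V' s' q' oV' VV' ss' gq'.
  apply: (sF _ _ (fun z => s (s' z)) (fun z => (q (s' z) * q' z)%g)) => //.
  + by move=> y Vy; exact/VU/VV'.
  + apply: smooth_on_mx => // i.
    exact: smooth_on_comp oV' VV' ss' (smooth_on_coord i oV ss).
  + by apply: gplotM => //; exact: gplot_comp oV oV' VV' ss' gq.
Qed.

Lemma smoothC_conv (v : functional G) (f : G -> C) : inU v -> smoothC f ->
  smoothC (fun g => v (fun g' => f (g * g')%g)).
Proof.
move=> Uv sf; apply: smoothCP => U p oU gp; apply: inU_sfam => //.
move=> k V s q oV VU ss gq; apply: smoothC_plot => //.
by apply: gplotM => //; exact: gplot_comp oU oV VU ss gp.
Qed.

Lemma inU_linear (u : functional G) : inU u -> forall (a : C) f g,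
  smoothC f -> smoothC g -> u (fun x => a * f x + g x) = a * u f + u g.
Proof.
elim=> {u} [x|c v Ac c1|b u v _ IHu _ IHv|u v _ IHu Uv IHv] a f g sf sg.
- by [].
- rewrite /tangent.
  have D (h : G -> R^o) : smooth_on (chart_cod c) (h \o chart_inv c) ->
      derivable (h \o chart_inv c) (c 1%g) v.
    move=> sh; apply/diff_derivable/smooth_on_differentiable; first exact: sh.
    by exists 1%g.
  have [/D f1 /D f2] := sf c Ac; have [/D g1 /D g2] := sg c Ac.
  case: a => a b.
  have -> : (fun x => complex.Re ((a +i* b)%C * f x + g x) : R^o) \o chart_inv c =
      fun y => a * complex.Re (f (chart_inv c y)) +
        (- b) * complex.Im (f (chart_inv c y)) + complex.Re (g (chart_inv c y)).
    apply/funext => y.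
    rewrite -[LHS]/(complex.Re ((a +i* b)%C * f (chart_inv c y) + g (chart_inv c y))).
    by rewrite Re_cadd Re_cmul mulNr.
  have -> : (fun x => complex.Im ((a +i* b)%C * f x + g x) : R^o) \o chart_inv c =
      fun y => a * complex.Im (f (chart_inv c y)) +
        b * complex.Re (f (chart_inv c y)) + complex.Im (g (chart_inv c y)).
    apply/funext => y.
    rewrite -[LHS]/(complex.Im ((a +i* b)%C * f (chart_inv c y) + g (chart_inv c y))).
    by rewrite Im_cadd Im_cmul.
  by rewrite (derive_lincomb a (- b) f1 f2 g1) (derive_lincomb a b f2 f1 g2) mulNr.
- rewrite IHu // IHv //; ring.
- rewrite /conv -(IHu a _ _ (smoothC_conv Uv sf) (smoothC_conv Uv sg)).
  by congr u; apply/funext => y; rewrite IHv //; exact: smoothC_mull.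
Qed.

Lemma inU0 (u : functional G) : inU u -> u (fun=> 0) = 0.
Proof.
move=> Uu; have := inU_linear Uu 1 (smoothC_cst 0) (smoothC_cst 0).
rewrite (_ : (fun x : G => 1 * 0 + 0 : C) = fun=> 0); last first.
  by apply/funext => x; rewrite mulr0 addr0.
by rewrite mul1r => H; apply: (@addrI _ (u (fun=> 0))); rewrite addr0 -H.
Qed.

Lemma inUZ (u : functional G) a f : inU u -> smoothC f ->
  u (fun x => a * f x) = a * u f.
Proof.
move=> Uu sf; have := inU_linear Uu a sf (smoothC_cst 0).
rewrite (_ : (fun x : G => a * f x + 0 : C) = fun x => a * f x); last first.
  by apply/funext => x; rewrite addr0.
by rewrite inU0 // addr0.
Qed.

Lemma inUD (u : functional G) f g : inU u -> smoothC f -> smoothC g ->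
  u (fun x => f x + g x) = u f + u g.
Proof.
move=> Uu sf sg; have := inU_linear Uu 1 sf sg.
rewrite (_ : (fun x : G => 1 * f x + g x : C) = fun x => f x + g x) ?mul1r //.
by apply/funext => x; rewrite mul1r.
Qed.

Lemma inU_sum (I : Type) (u : functional G) (s : seq I) (F : I -> G -> C) :
  inU u -> (forall i, smoothC (F i)) ->
  u (fun x => \sum_(i <- s) F i x) = \sum_(i <- s) u (F i).
Proof.
move=> Uu sF; elim: s => [|i s IHs].
  rewrite big_nil -[RHS](inU0 Uu); congr u.
  by apply/funext => x; rewrite big_nil.
rewrite big_cons -IHs -inUD //; last exact: smoothC_sum.
by congr u; apply/funext => x; rewrite big_cons.
Qed.

End LiePlots.

(** * Bump functions *)

Section Bump.
Variable R : realType.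

(* exp(-1/t) / t^k for t > 0, extended by 0; this family is closed under
   differentiation up to linear combinations. *)
Definition flat (k : nat) (t : R) : R :=
  if 0 < t then expR (- t^-1) * t^-1 ^+ k else 0.

Lemma flat_ge0 k t : 0 <= flat k t.
Proof.
rewrite /flat; case: ifPn => // t0.
by rewrite mulr_ge0 ?expR_ge0 // exprn_ge0 // invr_ge0 ltW.
Qed.

(** The single Taylor term exp(1/t) >= t^-(k+2) / (k+2)! leaves a factor t^2, which makes the
    difference quotient at 0 tend to 0. *)
Lemma flat_le k t : flat k t <= (k.+2)`!%:R * t ^+ 2.
Proof.
rewrite /flat; case: ifPn => [t0|_]; last first.
  by rewrite mulr_ge0 // sqr_ge0.
have y0 : 0 < t^-1 by rewrite invr_gt0.
have F0 : 0 < (k.+2)`!%:R :> R by rewrite ltr0n fact_gt0.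
have H : t^-1 ^+ k.+2 / (k.+2)`!%:R <= expR t^-1.
  by apply: le_trans (expR_ge1Dxn k.+1 (ltW y0)); rewrite lerDr.
rewrite expRN ler_pdivrMl ?expR_gt0 //.
rewrite ler_pdivrMr // in H.
have -> : expR t^-1 * (k.+2`!%:R * t ^+ 2) = expR t^-1 * k.+2`!%:R * t ^+ 2 by rewrite mulrA.
apply: le_trans (ler_wpM2r (sqr_ge0 t) H).
by rewrite -addn2 exprD -mulrA -exprMn mulVf ?gt_eqF // expr1n mulr1.
Qed.

Lemma is_derive_flat k (t : R) :
  is_derive t 1 (flat k) (flat k.+2 t - k%:R * flat k.+1 t).
Proof.
have [t0|t0|<-] := ltgtP 0 t.
- have tn0 : t != 0 by rewrite gt_eqF.
  have nE : \near t, expR (- t^-1) * t^-1 ^+ k = flat k t.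
    have oP : open [set x : R | 0 < x] by exact: open_gt.
    by apply: (near_open oP _ t0) => y /= y0; rewrite /flat y0.
  apply: (@near_eq_is_derive R R^o R^o (fun t => expR (- t^-1) * t^-1 ^+ k) _ _ _ _ nE).
  have dV : is_derive t 1 (fun t : R => t^-1) (- t^-1 ^+ 2).
    have := @is_deriveV R id t 1 1 tn0 (is_derive_id _ _).
    by rewrite /= -exprVn [_ *: _]mulr1.
  have dE : is_derive t 1 (fun t : R => expR (- t^-1)) (expR (- t^-1) * t^-1 ^+ 2).
    have dN : is_derive t 1 (fun t : R => - t^-1) (t^-1 ^+ 2).
      by have := is_deriveN dV; rewrite opprK.
    exact: (is_derive1_comp (is_derive_expR _) dN).
  have dX : is_derive t 1 (fun t : R => t^-1 ^+ k) (- (k%:R * t^-1 ^+ k.+1)).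
    case: (k) => [|j]; first by rewrite mul0r oppr0; exact: is_derive_cst.
    have := is_deriveX j.+1 dV.
    by rewrite [_ *: _]mulrN -mulrA -exprD addn2 exprfctE.
  apply: is_derive_eq (is_deriveM dE dX) _.
  rewrite /flat t0 /GRing.scale /=.
  have -> : t^-1 ^+ k.+2 = t^-1 ^+ 2 * t^-1 ^+ k by rewrite -exprD add2n.
  ring.
- have nE : \near t, cst 0 t = flat k t.
    have oP : open [set x : R | x < 0] by exact: open_lt.
    by apply: (near_open oP _ t0) => y /= y0; rewrite /flat ltNge ltW.
  apply: (@near_eq_is_derive R R^o R^o (cst 0) _ _ _ _ nE).
  rewrite /flat !ltNge !(ltW t0) /= mulr0 subr0; exact: is_derive_cst.
- have e0 : flat k.+2 0 - k%:R * flat k.+1 0 = 0.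
    by rewrite /flat ltxx mulr0 subr0.
  rewrite e0.
  have f0 : flat k 0 = 0 by rewrite /flat ltxx.
  pose c : R := (k.+2)`!%:R.
  have c0 : 0 < c by rewrite ltr0n fact_gt0.
  suff H : h^-1 *: ((flat k \o shift 0) (h *: 1) - flat k 0) @[h --> 0^'] --> 0.
    by apply: DeriveDef; [apply/cvg_ex; exists 0|exact/cvg_lim].
  apply/cvgrPdist_le => /= e e0'.
  near=> h.
  rewrite f0 subr0 addr0 [h *: 1]mulr1 sub0r normrN normrM normfV.
  have h0 : h != 0 by near: h; exact: nbhs_dnbhs_neq.
  have hn : 0 < `|h| by rewrite normr_gt0.
  rewrite ler_pdivrMl // ger0_norm ?flat_ge0 //.
  apply: le_trans (flat_le k h) _; rewrite -real_normK ?num_real // expr2 mulrCA.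
  rewrite ler_wpM2l // -ler_pdivlMl //.
  near: h; apply: dnbhs0_le; rewrite mulr_gt0 ?invr_gt0 //.
Unshelve. all: by end_near. Qed.

Lemma smooth_on_flat m k (U : set 'rV[R]_m) (q : 'rV[R]_m -> R^o) :
  open U -> smooth_on U q -> smooth_on U (fun x => flat k (q x) : R^o).
Proof.
move=> oU sq n; elim: n k => [|n IHn] k.
  move=> x Ux; apply: (@continuous_comp _ _ _ q (flat k)).
    exact: smooth_on_continuous sq Ux.
  apply: (@differentiable_continuous _ R R^o); apply/derivable1_diffP.
  by have [] := is_derive_flat k (q x).
have df t : differentiable (flat k : R -> R^o) t.
  by apply/derivable1_diffP; have [] := is_derive_flat k t.
split=> [x Ux|v].
  apply: (@differentiable_comp _ _ _ _ q (flat k)) => //.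
  exact: smooth_on_differentiable sq Ux.
apply: (Cn_on_congr (f := fun x =>
  (flat k.+2 (q x) + (- k%:R) * flat k.+1 (q x)) * 'D_v q x : R^o)) => //.
  move=> x Ux; have dq := smooth_on_differentiable sq Ux.
  rewrite [RHS](@deriveE _ _ _ (flat k \o q)); last exact: differentiable_comp.
  rewrite diff_comp //= -(deriveE v dq).
  have dk : derivable (flat k : R -> R^o) (q x) 1 by have [] := is_derive_flat k (q x).
  rewrite (deriv1E dk) derive1E (@derive_val _ _ _ _ _ _ _ (is_derive_flat k (q x))).
  by rewrite mulNr [RHS]mulrC.
apply: Cn_onM => //; last exact: (smooth_on_derive v sq).
by apply: Cn_onD => //; apply: Cn_onM => //; exact: Cn_on_cst.
Qed.

(** Strictness is what makes the bump below attain its maximum at the centre only. *)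
Lemma flat0_lt s t : 0 <= s -> s < t -> flat 0 s < flat 0 t.
Proof.
move=> s0 st; have t0 : 0 < t by exact: le_lt_trans st.
rewrite /flat t0 !expr0 !mulr1; case: ifPn => [s1|_]; last exact: expR_gt0.
by rewrite ltr_expR ltrN2 ltf_pV2.
Qed.

End Bump.

Section LieBump.
Variables (R : realType) (G : lieGroup R).
Local Notation C := R[i].

(** Serves two purposes: the closed set [Z] inside [O] gives cutoffs for maps defined on [O] only,
    and the uniqueness of the point of value 1 separates orbits. *)
Lemma lie_bump (g : G) (O : set G) : open O -> O g ->
  exists (f : G -> C) (Z : set G), [/\ smoothC f, closed Z, Z `<=` O,
    (forall x, ~ Z x -> f x = 0) /\ f g = 1 & forall x, f x = 1 -> x = g].
Proof.
move=> oO Og; have [HA cA] := lie_cover G; have [c Ac cg] := cA g.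
have [oc oc' ic cc] := HA c Ac.
pose a := c g; pose Om := chart_cod c `&` chart_inv c @^-1` O.
have oOm : open Om by exact: open_preimage_on oc' oO cc.
have Oma : Om a by split; [exists g|rewrite /= ic].
have [r r0 rOm] : exists2 r : R, 0 < r & closed_ball a r `<=` Om.
  have : nbhs a Om by exact: open_nbhs_nbhs.
  by move=> /nbhs_closedballP[r rOm]; exists r%:num.
(* The Euclidean square distance is smooth, whereas [closed_ball] refers to the maximum norm;
   positivity of [q] forces membership in that larger ball. *)
pose q (x : 'rV[R]_(lie_dim G)) : R^o := r ^+ 2 - \sum_i (x 0 i - a 0 i) ^+ 2.
have sq U : open U -> smooth_on U q.
  move=> oU; apply: smooth_onB => //; first exact: smooth_on_cst.
  apply: smooth_on_sum => // i.
  have sx : smooth_on U (fun x : 'rV[R]_(lie_dim G) => x 0 i - a 0 i : R^o).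
    apply: smooth_onB => //; last exact: smooth_on_cst.
    by apply: smooth_on_coord => //; exact: smooth_on_id.
  exact: smooth_onM.
have qB x : 0 < q x -> closed_ball a r x.
  rewrite /q subr_gt0 => qx; rewrite closed_ballE // /closed_ball_ /=.
  rewrite [leLHS]/Num.Def.normr /= mx_normrE; apply: bigmax_le; first exact: ltW.
  move=> [i j] _; rewrite /= (ord1 i) !mxE distrC -(@ler_pXn2r _ 2) ?nnegrE ?normr_ge0 ?(ltW r0) //.
  rewrite real_normK ?num_real //; apply: le_trans _ (ltW qx).
  by rewrite (bigD1 j) //= lerDl sumr_ge0 // => k _; rewrite sqr_ge0.
have qr x : q x <= r ^+ 2.
  by rewrite /q gerBl sumr_ge0 // => k _; rewrite sqr_ge0.
have qa x : q x = r ^+ 2 -> x = a.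
  rewrite /q => /eqP; rewrite -subr_eq0 addrAC subrr add0r oppr_eq0 => /eqP qx.
  apply/rowP => i; apply/eqP; rewrite -subr_eq0 -sqrf_eq0; apply/eqP.
  by apply: (psumr_eq0P _ qx) => // k _; rewrite sqr_ge0.
pose w := flat 0 (r ^+ 2).
have w0 : 0 < w by rewrite /w /flat exprn_gt0 // expr0 mulr1 expR_gt0.
pose b x := flat 0 (q x) / w.
pose f x : C := if x \in chart_dom c then Complex (b (c x)) 0 else 0.
(* Compact in a Hausdorff space, hence closed in the whole group and not just in the chart: its
   complement is open, and the extension of the bump by 0 is smooth. *)
pose Z := chart_inv c @` closed_ball a r.
have cZ : closed Z.
  apply: (compact_closed (@lie_hausdorff _ G)); apply: continuous_compact.
    by apply: continuous_in_subspaceT => y /set_mem /rOm[/cc].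
  apply: bounded_closed_compact; last exact: closed_ball_closed.
  rewrite closed_ballE //; exists (`|a| + r); split; first exact: num_real.
  move=> M aM x /= xr; apply: le_trans _ (ltW aM).
  by rewrite -lerBlDl; apply: le_trans xr; rewrite distrC; exact: lerB_dist.
have fZ x : ~ Z x -> f x = 0.
  move=> nZ; rewrite /f; case: ifPn => // /set_mem cx.
  suff : ~~ (0 < q (c x)) by rewrite /b /flat => /negPf ->; rewrite mul0r.
  by apply/negP => /qB B; apply: nZ; exists (c x) => //; rewrite ic.
exists f, Z; split=> //.
- apply: smoothCP => U p oU gp; apply: csmooth_on_local => x Ux.
  have [cp sp] := gp.
  have [cpx|ncpx] := pselect (chart_dom c (p x)).
    pose V := U `&` p @^-1` chart_dom c.
    have oV : open V by exact: open_preimage_on oU oc cp.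
    exists V; split=> //.
    apply: (csmooth_on_congr (f := fun y => Complex (b (c (p y))) 0) oV).
      by move=> y [_ cy]; rewrite /f mem_set.
    split; last exact: smooth_on_cst.
    apply: smooth_onM => //; last exact: smooth_on_cst.
    apply: smooth_on_flat => //.
    by apply: (smooth_on_comp oV (V := setT) _ (sp c Ac)) => //; exact: sq openT.
  pose V := U `&` p @^-1` (~` Z).
  have oV : open V by apply: open_preimage_on oU _ cp; exact: closed_openC.
  have Vx : V x.
    by split => // -[y /rOm[[z cz zy] _] yp]; apply: ncpx; rewrite -yp -zy ic.
  exists V; split=> //.
  by apply: (csmooth_on_congr (f := fun=> 0) oV) (csmooth_on_cst _ _) => y [_ /fZ].
- by move=> _ [y /rOm[_ Oy] <-].
- split=> //; rewrite /f mem_set // /b.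
  have -> : q (c g) = r ^+ 2.
    by rewrite /q big1 ?subr0 // => i _; rewrite subrr expr0n.
  by rewrite divff // gt_eqF.
move=> x; rewrite /f; case: ifPn => [/set_mem cx [bE]|_ /eqP]; last first.
  by rewrite eq_sym oner_eq0.
rewrite -(ic x cx) -(ic g cg); congr chart_inv; apply: qa.
apply/eqP; rewrite eq_le qr leNgt; apply/negP => qlt.
have bw : flat 0 (q (c x)) = w by exact: divr1_eq bE.
have [q0|q0] := leP 0 (q (c x)).
  by have := flat0_lt q0 qlt; rewrite bw ltxx.
by move: w0; rewrite -bw /flat (lt_gtF q0) ltxx.
Qed.
End LieBump.

(** * The induced modules *)

Section Bicross.
Variables (R : realType) (K L : lieGroup R) (mp : matched_pair K L).
Local Notation C := R[i].
Implicit Types (l : L) (kap : K -> C) (lam : L -> C) (h : hfam K L).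

Lemma gplot_lact m (U : set 'rV[R]_m) p q : open U -> gplot U p -> gplot U q ->
  (forall x, U x -> ldom mp (p x, q x)) ->
  gplot U (fun x => lact mp (p x) (q x)).
Proof.
move=> oU gp gq UD; have gpq := plot_pair (lie_cover K) (lie_cover L) oU gp gq.
have H := (plot_map (prod_atlas_cover (lie_cover K) (lie_cover L)) (lie_cover L)
  (@ldom_open _ _ _ mp) (lact_smooth mp) oU gpq UD).
exact: H.
Qed.

Lemma smoothC_lact l lam : global_at mp l -> smoothC lam ->
  smoothC (fun x => lam (lact mp x l)).
Proof.
move=> [gl _] sl; apply: smoothCP => U p oU gp.
by apply: smoothC_plot => //; apply: gplot_lact => //; exact: plot_cst.
Qed.

Lemma ldom_slice_open (k : K) : open [set l | ldom mp (k, l)].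
Proof.
rewrite openE => l Dl; have := @ldom_open _ _ _ mp; rewrite openE => /(_ _ Dl).
move=> [[A B] /= [Ak Bl] AB].
by apply: filterS Bl => l' Bl'; apply: AB; split => //=; exact: nbhs_singleton.
Qed.

(** The open slice where k |> - is defined and the complement of [Z] cover L. On the first the
    product is a product of smooth functions, on the second it is 0, whatever the value of [lact]
    there. *)
Lemma smoothC_cutoff (k : K) lam (mu : L -> C) (Z : set L) :
  smoothC lam -> smoothC mu -> closed Z -> (forall l, Z l -> ldom mp (k, l)) ->
  (forall l, ~ Z l -> mu l = 0) ->
  smoothC (fun l => lam (lact mp k l) * mu l).
Proof.
move=> sl sm cZ ZD mu0; apply: smoothCP => U p oU gp.
have [cp sp] := gp; apply: csmooth_on_local => x Ux.
have oD := ldom_slice_open k.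
have [Zx|nZx] := pselect (Z (p x)).
  pose V := U `&` p @^-1` [set l | ldom mp (k, l)].
  have oV : open V by exact: open_preimage_on oU oD cp.
  exists V; split=> //; first by split => //; exact: ZD.
  have gpV : gplot V p by apply: plot_sub gp => y [].
  apply: csmooth_onM => //; last exact: smoothC_plot.
  apply: smoothC_plot => //; apply: gplot_lact => //; first exact: plot_cst.
  by move=> y [].
pose V := U `&` p @^-1` (~` Z).
have oV : open V by apply: open_preimage_on oU _ cp; exact: closed_openC.
exists V; split=> //.
apply: (csmooth_on_congr (f := fun=> 0) oV) (csmooth_on_cst _ _) => y [_ /mu0 ->].
by rewrite mulr0.
Qed.

(* kappa <| h for the module induced by l. *)
Definition actH l kap h : K -> C := fun x => h (lact mp x l) (fun y => kap (y * x)%g).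

(* The star of an element of U^(k) is only shown to agree with an element of
   U^(k) on smooth functions. *)
Definition inH_sm h := exists n (u : 'I_n -> functional K) (lam : 'I_n -> L -> C),
  (forall i, inU (u i) /\ smoothC (lam i)) /\
  forall l kap, smoothC kap -> h l kap = tens_sum u lam l kap.

Lemma inH_sm_inH h : inH h -> inH_sm h.
Proof. by move=> [n [u [lam [H ->]]]]; exists n, u, lam. Qed.

Lemma inH_tens (u : functional K) lam : inU u -> smoothC lam -> inH (tens u lam).
Proof.
move=> Uu sl; exists 1%N, (fun=> u), (fun=> lam); split=> //.
by apply/funext => l; apply/funext => kap; rewrite /tens_sum big_ord1.
Qed.

Lemma inH_linear h l (a : C) f g : inH h -> smoothC f -> smoothC g ->
  h l (fun x => a * f x + g x) = a * h l f + h l g.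
Proof.
move=> [n [u [lam [H ->]]]] sf sg; rewrite /tens_sum mulr_sumr -big_split /=.
apply: eq_bigr => i _; have [Ui _] := H i.
by rewrite /tens inU_linear // mulrDl mulrA.
Qed.

Lemma smoothC_right_conv (u : functional K) kap : inU u -> smoothC kap ->
  smoothC (fun x => u (fun y => kap (y * x)%g)).
Proof.
move=> Uu sk; apply: smoothCP => U p oU gp; apply: inU_sfam => //.
move=> k V s q oV VU ss gq; apply: smoothC_plot => //.
by apply: gplotM => //; exact: gplot_comp oU oV VU ss gp.
Qed.

Lemma actH_smooth l kap h : global_at mp l -> inH h -> smoothC kap ->
  smoothC (actH l kap h).
Proof.
move=> gl [n [u [lam [H ->]]]] sk.
apply: (smoothC_sum _ (F := fun i x => u i (fun y => kap (y * x)%g) * lam i (lact mp x l))) => i.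
have [Ui sl] := H i.
apply: smoothCM; first exact: (smoothC_right_conv Ui sk).
exact: smoothC_lact.
Qed.

Lemma rreg_act l kap h : smoothC kap -> rreg mp (elt kap l) h (elt (actH l kap h) l).
Proof. by move=> sk h1 h2 H; rewrite /elt /dtens /grouplike (H _ _ sk). Qed.

(* The elements delta_k (x) mu of H, with mu supported where k |> - is defined,
   separate points of K. *)
Lemma rreg_uniq l kap kap1 h : global_at mp l -> inH_sm h -> smoothC kap ->
  rreg mp (elt kap l) h (elt kap1 l) -> kap1 = actH l kap h.
Proof.
move=> [gl _] [n [u [lam [Hul hE]]]] sk H; apply/funext => x.
have oD := ldom_slice_open x.
have [mu [Z [smu cZ ZD [mu0 mu1] _]]] := lie_bump oD (gl x).
have H1 : inH (tens (grouplike x) mu) by apply: inH_tens => //; exact: inU_grouplike.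
(* The product of [h] with [tens (grouplike x) mu]; the cutoff [mu] keeps its second factors smooth
   on all of L, so that the pairing condition may be tested on it. *)
have H2 : inH (tens_sum (fun i => conv (u i) (grouplike x))
                        (fun i l => lam i (lact mp x l) * mu l)).
  exists n, (fun i => conv (u i) (grouplike x)),
    (fun i l => lam i (lact mp x l) * mu l); split=> // i; have [Ui sl] := Hul i.
  split; first by apply: inU_conv => //; exact: inU_grouplike.
  exact: smoothC_cutoff sl smu cZ ZD mu0.
have pr : prodH mp h (tens (grouplike x) mu)
    (tens_sum (fun i => conv (u i) (grouplike x))
              (fun i l => lam i (lact mp x l) * mu l)).
  move=> l' kap' sk'.
  rewrite -[RHS]/(h (lact mp x l') (fun k => kap' (k * x)%g) * mu l') hE; last exact: smoothC_mulr.
  by rewrite /tens_sum mulr_suml; apply: eq_bigr => i _; rewrite /tens mulrA.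
(* Since mu(l) = 1, the left side is [kap1 x], and the right side is the value of [actH] at [x]. *)
have := H (exist _ _ H1) (exist _ _ H2) pr.
rewrite /elt /dtens /= {1}/grouplike /tens {1}/grouplike mu1 mulr1 => ->.
by rewrite /grouplike (pr _ _ sk) /mulH /tens mu1 mulr1.
Qed.

Lemma inH_grouplike (k : K) : inH (tens (grouplike k) (fun=> 1) : hfam K L).
Proof. by apply: inH_tens; [exact: inU_grouplike|exact: smoothC_cst]. Qed.

Definition group_Hel (k : K) : Hel K L := exist _ _ (inH_grouplike k).

Lemma elt_group kap l k : elt kap l (group_Hel k) = kap k.
Proof. by rewrite /elt /dtens /grouplike /= /tens mulr1. Qed.

Lemma elt_inj kap kap' l : elt kap l = elt kap' l -> kap = kap'.
Proof. by move=> E; apply/funext => k; rewrite -(elt_group kap l) E elt_group. Qed.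

Lemma elt_linear l (a : C) kap kap' : smoothC kap -> smoothC kap' ->
  elt (fun k => a * kap k + kap' k) l =
  (fun h : Hel K L => a * elt kap l h + elt kap' l h).
Proof.
move=> sk sk'; apply/funext => h; rewrite /elt /dtens /grouplike.
by apply: inH_linear => //; exact: svalP.
Qed.

Lemma mulH_Felt h lam l kap : mulH mp h (Felt lam) l kap = h l kap * lam l.
Proof.
rewrite /mulH /Felt /tens /grouplike lact1l; congr (h l _ * _).
by apply/funext => k; rewrite mulg1.
Qed.

Lemma ind_carrierE l : ind_carrier mp l = [set elt kap l | kap in @smoothC R K].
Proof.
apply/seteqP; split=> [f [[n [kap [v [Hv ->]]]] Hl]|_ [kap sk <-]]; last first.
  split.
    exists 1%N, (fun=> kap), (fun=> grouplike l); split.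
      by move=> _; split=> //; exact: inU_grouplike.
    by apply/funext => h; rewrite big_ord1.
  move=> lam sl h h'' pr; rewrite /elt /dtens /grouplike pr // mulH_Felt.
  exact: mulrC.
pose f0 : hdual K L := fun h : Hel K L => \sum_(i < n) dtens (kap i) (v i) h.
have ft u mu (Htens : inH (tens u mu)) : smoothC mu ->
    f0 (exist _ _ Htens) = \sum_i u (kap i) * v i mu.
  move=> smu; apply: eq_bigr => i _; have [_ Uv] := Hv i.
  by rewrite /dtens /= /tens inUZ.
(* The value of the functional at the group-like k tensored with the constant 1. *)
exists (fun k => \sum_i v i (fun=> 1) * kap i k).
  by apply: smoothC_sum => i; apply: smoothCZ; have [] := Hv i.
apply/esym/funext => -[h Hh]; have [m [u [mu [Hu hE]]]] := Hh.
(* The eigenvector condition for the function [mu j], tested on [u j] tensored with 1, whose product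
   with [Felt (mu j)] is the j-th term of [h]. *)
have fmu j : \sum_i u j (kap i) * v i (mu j) =
    mu j l * \sum_i u j (kap i) * v i (fun=> 1).
  have [Uj sj] := Hu j.
  have H1 := inH_tens Uj (smoothC_cst 1); have H2 := inH_tens Uj sj.
  rewrite -(ft _ _ H1) ?(ft _ _ H2) //; last exact: smoothC_cst.
  rewrite -(ft _ _ H2) //; apply/esym; apply: Hl => // l' kap' _.
  by rewrite mulH_Felt /= /tens mulr1.
transitivity (\sum_i \sum_j u j (kap i) * v i (mu j)).
  rewrite -[LHS]/(\sum_(i < n) dtens (kap i) (v i) (exist _ h Hh)).
  apply: eq_bigr => i _; have [_ Uv] := Hv i.
  rewrite /dtens /= hE.
  rewrite -[LHS]/(v i (fun l => \sum_j u j (kap i) * mu j l)).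
  rewrite (inU_sum _ (F := fun j l => u j (kap i) * mu j l)) //.
    by apply: eq_bigr => j _; have [_ sj] := Hu j; rewrite inUZ.
  by move=> j; apply: smoothCZ; have [] := Hu j.
rewrite /elt /dtens /grouplike /= hE /tens_sum.
rewrite exchange_big /=; apply: eq_bigr => j _; have [Uj sj] := Hu j.
rewrite fmu /tens inU_sum // => [|i]; last by apply: smoothCZ; have [] := Hv i.
rewrite mulrC; congr (_ * _); apply: eq_bigr => i _; have [sk _] := Hv i.
by rewrite inUZ // mulrC.
Qed.

End Bicross.

(** * Orbits and isomorphism classes *)

Section Modules.
Variables (R : realType) (K L : lieGroup R) (mp : matched_pair K L).
Local Notation C := R[i].
Implicit Types (l : L) (kap : K -> C) (lam : L -> C) (h : hfam K L).

Lemma elt_bij l : set_bij (@smoothC R K) (ind_carrier mp l) (fun kap => elt kap l).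
Proof.
rewrite ind_carrierE; split.
- by move=> kap sk; exists kap.
- by move=> kap kap' _ _; exact: elt_inj.
- by [].
Qed.

Lemma ind_carrier_action l f h : global_at mp l -> ind_carrier mp l f -> inH h ->
  exists! f', ind_carrier mp l f' /\ rreg mp f h f'.
Proof.
move=> gl; rewrite ind_carrierE => -[kap sk <-] Hh.
exists (elt (actH mp l kap h) l); split.
  split; last exact: rreg_act.
  by exists (actH mp l kap h) => //; exact: actH_smooth.
move=> f' [[kap1 sk1 <-] H].
by rewrite (rreg_uniq gl (inH_sm_inH Hh) sk H).
Qed.

Lemma ind_act_actH l kap h : global_at mp l -> inH h -> smoothC kap ->
  ind_act mp l kap h (actH mp l kap h).
Proof. by move=> gl Hh sk; split; [exact: actH_smooth|exact: rreg_act]. Qed.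

Lemma ind_actE l kap h kap' : global_at mp l -> inH_sm h -> smoothC kap ->
  ind_act mp l kap h kap' -> kap' = actH mp l kap h.
Proof. by move=> gl Hh sk [_ H]; exact: rreg_uniq H. Qed.

Lemma actH_Kelt l kap k : actH mp l kap (@Kelt R K L k) = fun x => kap (k * x)%g.
Proof. by apply/funext => x; rewrite /actH /Kelt /tens mulr1. Qed.

Lemma actH_Felt l kap lam :
  actH mp l kap (@Felt R K L lam) = fun x => kap x * lam (lact mp x l).
Proof. by apply/funext => x; rewrite /actH /Felt /tens /grouplike mul1g. Qed.

Lemma inH_Kelt k : inH (@Kelt R K L k).
Proof. exact: inH_grouplike. Qed.

Lemma inH_Felt lam : smoothC lam -> inH (@Felt R K L lam).
Proof. by move=> sl; apply: inH_tens => //; exact: inU_grouplike. Qed.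

Lemma global_lactA l k k' : global_at mp l ->
  lact mp (k * k')%g l = lact mp k (lact mp k' l).
Proof. by move=> [g1 g2]; apply: lactA. Qed.

Lemma global_lact l k : global_at mp l -> global_at mp (lact mp k l).
Proof.
move=> gl; split=> [k'|k' k'']; first by have [_ g2] := gl; exact: g2.
by rewrite -global_lactA //; have [_ g2] := gl; exact: g2.
Qed.

Lemma module_iso_refl (M : set (hdual K L)) : module_iso mp M M.
Proof. by exists id; split=> //; split=> // f Mf; exists f. Qed.

Lemma module_iso_trans (M N P : set (hdual K L)) :
  module_iso mp M N -> module_iso mp N P -> module_iso mp M P.
Proof.
move=> [S [bS lS rS]] [T [bT lT rT]]; exists (T \o S); split.
- exact: set_bij_comp bS bT.
- move=> a f g Mf Mg /=; rewrite lS // lT //.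
    by have [+ _ _] := bS; apply.
  by have [+ _ _] := bS; apply.
- move=> f f' h Mf Mf' Hh r; have [SN _ _] := bS.
  by apply: rT => //; [exact: SN|exact: SN|exact: rS].
Qed.

(* kappa |-> kappa(- k) intertwines the actions induced by l and by k |> l. *)
Lemma module_iso_lact l k : global_at mp l ->
  module_iso mp (ind_carrier mp l) (ind_carrier mp (lact mp k l)).
Proof.
move=> gl; have gl' := global_lact k gl.
(* The map has to be defined on all of [hdual]; evaluation at group-likes recovers kappa from
   [elt kap l]. *)
pose T (f : hdual K L) := elt (fun x => f (group_Hel L (x * k)%g)) (lact mp k l).
have TE kap : T (elt kap l) = elt (fun x => kap (x * k)%g) (lact mp k l).
  by congr (elt _ _); apply/funext => x; rewrite elt_group.
exists T; rewrite !ind_carrierE; split.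
- split.
  + move=> _ [kap sk <-]; rewrite TE; exists (fun x => kap (x * k)%g) => //.
    exact: smoothC_mulr.
  + move=> f g /set_mem[kap sk <-] /set_mem[kap' sk' <-].
    rewrite !TE => /elt_inj E; congr (elt _ _); apply/funext => x.
    by have := congr1 (fun f => f (x * k^-1)%g) E; rewrite !mulgVK.
  + move=> _ [kap sk <-]; exists (elt (fun x => kap (x * k^-1)%g) l).
      by exists (fun x => kap (x * k^-1)%g) => //; exact: smoothC_mulr.
    by rewrite TE; congr (elt _ _); apply/funext => x; rewrite mulgK.
- move=> a f g [kap sk <-] [kap' sk' <-].
  rewrite -elt_linear // !TE -elt_linear //; exact: smoothC_mulr.
- move=> f f' h [kap sk <-] [kap' sk' <-] Hh r.
  rewrite (rreg_uniq gl (inH_sm_inH Hh) sk r) !TE.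
  (* Covariance of [actH], from (x k) |> l = x |> (k |> l). *)
  have -> : (fun x => actH mp l kap h (x * k)%g) =
      actH mp (lact mp k l) (fun x => kap (x * k)%g) h.
    apply/funext => x; rewrite /actH global_lactA //; congr (h _ _).
    by apply/funext => y; rewrite mulgA.
  by apply: rreg_act; exact: smoothC_mulr.
Qed.

Lemma Korbit_eq l l' : global_at mp l -> Korbit mp l = Korbit mp l' ->
  exists k, l' = lact mp k l.
Proof.
move=> gl E; have : Korbit mp l' l' by exists 1%g => //; rewrite lact1l.
by rewrite -E => -[k _ <-]; exists k.
Qed.

Lemma iso_class_lact l k : global_at mp l ->
  iso_class mp l = iso_class mp (lact mp k l).
Proof.
move=> gl; have lk : lact mp k^-1%g (lact mp k l) = l.
  by rewrite -global_lactA // mulVg lact1l.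
apply/seteqP; split=> M [l' gl' [ME isoM]]; exists l' => //; split=> //.
  (* The isomorphism back is the one for k^-1, which sends k |> l to l. *)
  apply: module_iso_trans isoM; rewrite -{2}lk.
  exact/module_iso_lact/global_lact.
by apply: module_iso_trans isoM; exact: module_iso_lact.
Qed.

(* If l' is not in the orbit of l, there is a function lambda vanishing at l'
   only; then lambda acts invertibly on the module induced by l, but all the
   kappa lambda in the module induced by l' vanish at 1. *)
Lemma module_iso_orbit l l' : global_at mp l -> global_at mp l' ->
  module_iso mp (ind_carrier mp l) (ind_carrier mp l') ->
  exists k, l' = lact mp k l.
Proof.
move=> gl gl' [T [[Tfun _ Tsurj] _ Tact]]; apply: contrapT => nk.
have [b [Z [sb _ _ [_ bl'] b1]]] := lie_bump openT (I : setT l').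
pose lam x : C := 1 - b x.
have sl : smoothC lam.
  apply: smoothCD; first exact: smoothC_cst.
  under [X in smoothC X]eq_fun do rewrite -mulN1r; exact: smoothCZ.
have lam0 k : lam (lact mp k l) != 0.
  by rewrite /lam subr_eq0 eq_sym; apply/eqP => /b1 E; apply: nk; exists k.
have sV : smoothC (fun x => (lam (lact mp x l))^-1).
  apply: smoothCP => U p oU gp; apply: csmooth_onV => //.
  exact: (smoothC_plot (f := fun x => lam (lact mp x l)) oU gp (smoothC_lact gl sl)).
rewrite !ind_carrierE in Tfun Tsurj Tact.
(* The constant 1 is the image under [T] of some kap, and kap is kap' acted on by [lam]. Hence 1 is
   the image of kap' acted on by [lam] in the other module, which is impossible at the identity of
   K. *)
have [_ [kap sk <-] T1] := Tsurj _ (ex_intro2 _ _ _ (smoothC_cst 1) erefl).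
pose kap' x := kap x * (lam (lact mp x l))^-1.
have sk' : smoothC kap' by exact: smoothCM.
have [kap2 sk2 T2] : [set elt kap l' | kap in @smoothC R K] (T (elt kap' l)).
  by apply: Tfun; exists kap'.
have r : rreg mp (elt kap' l) (@Felt R K L lam) (elt kap l).
  have -> : kap = actH mp l kap' (@Felt R K L lam).
    by rewrite actH_Felt; apply/funext => x; rewrite /kap' divfK.
  exact: rreg_act.
have := Tact _ _ _ _ _ (inH_Felt sl) r.
rewrite -T2 T1 => H.
have /(congr1 (fun f => f 1%g)) := rreg_uniq gl' (inH_sm_inH (inH_Felt sl)) sk2
   (H (ex_intro2 _ _ _ sk' erefl) (ex_intro2 _ _ _ sk erefl)).
rewrite actH_Felt lact1l /lam bl' subrr mulr0 => /eqP.
by rewrite oner_eq0.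
Qed.

Lemma orbit_correspondence :
  exists Phi : set L -> set (set (hdual K L)),
    set_bij (global_orbits mp) (induced_classes mp) Phi /\
    (forall l, global_at mp l -> Phi (Korbit mp l) = iso_class mp l).
Proof.
(* A representative is chosen in each orbit; the default value [point] can only occur off
   [global_orbits]. *)
pose rep O := [set l | global_at mp l /\ Korbit mp l = O].
pose Phi O := iso_class mp (xget point (rep O)).
have PhiE l : global_at mp l -> Phi (Korbit mp l) = iso_class mp l.
  move=> gl; rewrite /Phi; case: xgetP => [l' _ [gl' E]|/(_ l)[]//].
  by have [k ->] := Korbit_eq gl' E; exact: iso_class_lact.
exists Phi; split=> //; split.
- by move=> _ [l gl <-]; exists l => //; rewrite PhiE.
- move=> _ _ /set_mem[l gl <-] /set_mem[l' gl' <-]; rewrite !PhiE // => E.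
  have : iso_class mp l (ind_carrier mp l).
    by exists l => //; split=> //; exact: module_iso_refl.
  rewrite E => -[l2 _ [_ /(module_iso_orbit gl' gl)[k ->]]].
  apply/seteqP; split=> _ [k' _ <-].
    by exists (k' * k)%g => //; rewrite global_lactA.
  exists (k' * k^-1)%g => //.
  by rewrite -global_lactA // mulgVK.
- by move=> _ [l gl <-]; exists (Korbit mp l); [exists l|exact: PhiE].
Qed.

End Modules.

(** * Commutation of distributions in separate variables *)

Section Schwarz.
Variable R : realType.

Lemma is_derive_line (V W : normedModType R) (f : V -> W) p v (s : R) :
  derivable f (p + s *: v) v ->
  is_derive s 1 (fun s => f (p + s *: v)) ('D_v f (p + s *: v)).
Proof.
move=> df.
have E h : f (p + (h *: 1 + s) *: v) = f (h *: v + (p + s *: v)).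
  by rewrite [h *: 1]mulr1 scalerDl addrCA.
apply: DeriveDef; last exact: eq_derive_line.
rewrite /derivable in df *.
rewrite (_ : (fun h : R => _) = fun h : R =>
  h^-1 *: ((f \o shift (p + s *: v)) (h *: v) - f (p + s *: v))) //.
by apply/funext => h /=; rewrite E.
Qed.

(* The mean value theorem in the direction v, followed by the differentiability
   of D_v f at x. *)
Lemma second_difference m (U : set 'rV[R]_m) (f : 'rV[R]_m -> R^o) x v w e :
  open U -> U x -> smooth_on U f -> 0 < e ->
  \forall h \near 0^'+, `|f (x + h *: w + h *: v) - f (x + h *: v) -
    (f (x + h *: w) - f x) - h ^+ 2 * 'D_w ('D_v f) x| <= e * h ^+ 2.
Proof.
move=> oU Ux sf e0; pose g : 'rV[R]_m -> R^o := 'D_v f.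
have sg : smooth_on U g by exact: smooth_on_derive.
have dg := smooth_on_differentiable sg Ux.
(* The two increments compared at the end have norms at most h(|v| + |w|) and h|v|, with sum at most
   h M; the 1 makes [M] positive. *)
pose M : R := 2 * `|v| + `|w| + 1.
have M0 : 0 < M by rewrite ltr_wpDl // addr_ge0 // mulr_ge0.
have eM0 : 0 < e / M by rewrite divr_gt0.
have [d d0 Hd] : exists2 d : R, 0 < d & forall y, `|y| < d ->
    U (y + x) /\ `|g (y + x) - (g x + 'd g x y)| <= e / M * `|y|.
  have nU : \forall y \near (0 : 'rV[R]_m), U (y + x).
    have : nbhs x U by exact: open_nbhs_nbhs.
    by rewrite -[nbhs x U]/(\near x, U x) (near_shift 0 x) /= subr0.
  have ng : \forall y \near (0 : 'rV[R]_m), `|g (y + x) - (g x + 'd g x y)| <= e / M * `|y|.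
    by have /eqaddoP /(_ _ eM0) := diff_locally dg.
  have : nbhs (0 : 'rV[R]_m) [set y | U (y + x) /\
      `|g (y + x) - (g x + 'd g x y)| <= e / M * `|y|] by exact: filterI nU ng.
  move=> /nbhs_ballP[d d0 Hd].
  exists d => // y yd; apply: Hd.
  by rewrite -ball_normE /= sub0r normrN.
near=> h.
have h0 : 0 < h by [].
have hd : h * M < d.
  by rewrite -ltr_pdivlMr //; near: h; apply: nbhs_right_lt; rewrite divr_gt0.
have bnd s t : 0 <= s <= h -> 0 <= t <= h -> `|s *: v + t *: w| <= s * `|v| + t * `|w|.
  move=> /andP[s0 _] /andP[t0 _]; apply: le_trans (ler_normD _ _) _.
  by rewrite !normrZ !ger0_norm.
have small s t : 0 <= s <= h -> 0 <= t <= h -> `|s *: v + t *: w| < d.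
  move=> sh th; apply: le_lt_trans (bnd _ _ sh th) _; apply: le_lt_trans hd.
  have sv : s * `|v| <= h * `|v| by rewrite ler_wpM2r //; case/andP: sh.
  have tw : t * `|w| <= h * `|w| by rewrite ler_wpM2r //; case/andP: th.
  have hv : 0 <= h * `|v| by rewrite mulr_ge0 // ltW.
  rewrite /M; lra.
have assoc s t : x + t *: w + s *: v = (s *: v + t *: w) + x.
  by rewrite -addrA addrC [t *: w + _]addrC.
have Us s t : 0 <= s <= h -> 0 <= t <= h -> U (x + t *: w + s *: v).
  by move=> sh th; rewrite assoc; apply: (Hd _ _).1; exact: small.
have h00 : 0 <= (0 : R) <= h by rewrite lexx ltW.
have hhh : 0 <= h <= h by rewrite lexx ltW.
(* The term [0 *: w] gives both summands the same shape, so that the bounds in [s] and [t] apply to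
   both. *)
pose phi s : R := f (x + h *: w + s *: v) - f (x + 0 *: w + s *: v).
pose dphi s : R := g (x + h *: w + s *: v) - g (x + 0 *: w + s *: v).
have dp s : 0 <= s <= h -> is_derive s 1 phi (dphi s).
  move=> sh; apply: (@is_deriveB _ R^o R^o); apply: is_derive_line.
    apply/diff_derivable/(smooth_on_differentiable sf); exact: Us.
  apply/diff_derivable/(smooth_on_differentiable sf); exact: Us.
have [c cI E] : exists2 c, c \in `]0, h[ & phi h - phi 0 = dphi c * (h - 0).
  apply: MVT => //.
    by move=> s; rewrite in_itv /= => /andP[s0 s1]; apply: dp; rewrite !ltW.
  apply: derivable_within_continuous => s; rewrite in_itv /= => sh.
  by have [] := dp s sh.
have ch : 0 <= c <= h.
  by move: cI; rewrite in_itv /= => /andP[s0 s1]; rewrite !ltW.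
have [_ H1] := Hd _ (small c h ch hhh).
have [_ H0] := Hd _ (small c 0 ch h00).
have B1 := bnd _ _ ch hhh; have B0 := bnd _ _ ch h00.
have -> : f (x + h *: w + h *: v) - f (x + h *: v) - (f (x + h *: w) - f x) =
    phi h - phi 0 by rewrite /phi !scale0r !addr0.
rewrite E subr0 /dphi !assoc (deriveE w dg).
set G1 := g _; set G0 := g _; set A := 'd g x w.
have L1 : 'd g x (c *: v + h *: w) = c * 'd g x v + h * A by rewrite linearD !linearZ.
have L0 : 'd g x (c *: v + 0 *: w) = c * 'd g x v.
  by rewrite scale0r addr0 linearZ.
rewrite L1 -/G1 in H1; rewrite L0 -/G0 in H0.
(* The value of [g] at [x] and the term in [v] cancel between the two first-order expansions; only
   their errors remain. *)
have -> : (G1 - G0) * h - h ^+ 2 * A = h *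
   ((G1 - (g x + (c * 'd g x v + h * A))) - (G0 - (g x + c * 'd g x v))) by ring.
rewrite normrM (gtr0_norm h0) expr2 mulrCA ler_wpM2l ?(ltW h0) //.
apply: le_trans (ler_normB _ _) _; apply: le_trans (lerD H1 H0) _.
rewrite -mulrDr -mulrA ler_wpM2l ?(ltW e0) // ler_pdivrMl //.
apply: le_trans (lerD B1 B0) _.
have cv : c * `|v| <= h * `|v| by rewrite ler_wpM2r //; case/andP: ch.
rewrite /M; lra.
Unshelve. all: by end_near. Qed.

(** The second difference is symmetric in [v] and [w]: after division by h^2, both mixed derivatives
    lie within e / 2 of the same number. *)
Lemma schwarz m (U : set 'rV[R]_m) (f : 'rV[R]_m -> R^o) x v w :
  open U -> U x -> smooth_on U f -> 'D_v ('D_w f) x = 'D_w ('D_v f) x.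
Proof.
move=> oU Ux sf; apply/eqP; rewrite -subr_eq0 -normr_le0.
apply/ler_addgt0Pr => e e0; rewrite add0r.
have e20 : 0 < e / 2 by rewrite divr_gt0.
have H1 := second_difference v w oU Ux sf e20.
have H2 := second_difference w v oU Ux sf e20.
have [h [[B1 B2] h0]] := @filter_ex _ _ _ _ (filterI (filterI H1 H2) (nbhs_right_gt 0)).
have h2 : 0 < h ^+ 2 by rewrite exprn_gt0.
rewrite -(ler_pM2r h2) -[X in _ * X](gtr0_norm h2) -normrM.
rewrite (addrAC x) in B2; move: B1 B2; set D1 := 'D_w _ _; set D2 := 'D_v _ _.
set F := f (x + h *: w + h *: v); set F1 := f (x + h *: v); set F2 := f (x + h *: w).
move=> B1 B2.
have -> : (D2 - D1) * h ^+ 2 = (F - F1 - (F2 - f x) - h ^+ 2 * D1) -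
    (F - F2 - (F1 - f x) - h ^+ 2 * D2) by ring.
apply: le_trans (ler_normB _ _) _; apply: le_trans (lerD B1 B2) _.
by rewrite -mulrDl -splitr.
Qed.

End Schwarz.

Section Swap.
Variables (R : realType).
Local Notation C := R[i].

(** Smoothness on the product of [G] and [H], tested on pairs of plots with a common parameter, so
    that no Lie group structure on the product is formed and the two variables play symmetric
    roles. *)
Definition jsmooth (G H : lieGroup R) (F : G -> H -> C) : Prop :=
  forall m (U : set 'rV[R]_m) p q, open U -> gplot U p -> gplot U q ->
    csmooth_on U (fun x => F (p x) (q x)).

Lemma jsmooth_sym (G H : lieGroup R) (F : G -> H -> C) :
  jsmooth F -> jsmooth (fun y x => F x y).
Proof. by move=> sF m U p q oU gp gq; exact: sF. Qed.

Lemma jsmooth_l (G H : lieGroup R) (F : G -> H -> C) y :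
  jsmooth F -> smoothC (fun x => F x y).
Proof. by move=> sF; apply: smoothCP => U p oU gp; apply: sF => //; exact: plot_cst. Qed.

Lemma jsmooth_r (G H : lieGroup R) (F : G -> H -> C) x :
  jsmooth F -> smoothC (F x).
Proof. by move=> /jsmooth_sym/jsmooth_l. Qed.

Lemma jsmooth_apply_r (G H : lieGroup R) (F : G -> H -> C) (v : functional H) :
  jsmooth F -> inU v -> smoothC (fun x => v (F x)).
Proof.
move=> sF Uv; apply: smoothCP => U p oU gp; apply: inU_sfam => // k V s q oV VU ss gq.
by apply: sF => //; exact: gplot_comp oU oV VU ss gp.
Qed.

Lemma jsmooth_apply_l (G H : lieGroup R) (F : G -> H -> C) (u : functional G) :
  jsmooth F -> inU u -> smoothC (fun y => u (fun x => F x y)).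
Proof. by move=> /jsmooth_sym/jsmooth_apply_r; exact. Qed.

Lemma jsmooth_mulr (G H : lieGroup R) (F : G -> H -> C) (v : functional H) :
  jsmooth F -> inU v -> jsmooth (fun x y => v (fun y' => F x (y * y')%g)).
Proof.
move=> sF Uv m U p q oU gp gq; apply: inU_sfam => // k V s r oV VU ss gr.
apply: sF => //; first exact: gplot_comp oU oV VU ss gp.
by apply: gplotM => //; exact: gplot_comp oU oV VU ss gq.
Qed.

Lemma jsmooth_mull (G H : lieGroup R) (F : G -> H -> C) (u : functional G) :
  jsmooth F -> inU u -> jsmooth (fun x y => u (fun x' => F (x * x')%g y)).
Proof. by move=> /jsmooth_sym/jsmooth_mulr HF /HF /jsmooth_sym. Qed.

Lemma jsmooth_transl (G H : lieGroup R) (F : G -> H -> C) g :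
  jsmooth F -> jsmooth (fun x y => F (g * x)%g y).
Proof.
move=> sF m U p q oU gp gq; apply: sF => //.
by apply: gplotM => //; exact: plot_cst.
Qed.

Lemma jsmooth_charts (G H : lieGroup R) (F : G -> H -> C)
    (c : chart R G (lie_dim G)) (d : chart R H (lie_dim H)) :
  lie_atlas c -> lie_atlas d -> jsmooth F ->
  open (chart_cod (prod_chart c d)) /\ csmooth_on (chart_cod (prod_chart c d))
    (fun z => F (chart_inv c (lsubmx z)) (chart_inv d (rsubmx z))).
Proof.
move=> Ac Ad sF.
have oW : open (chart_cod (prod_chart c d)).
  have [HA _] := prod_atlas_cover (lie_cover G) (lie_cover H).
  by have [] := HA (prod_chart c d) (ex_intro _ c (ex_intro _ d (And3 Ac Ad erefl))).
split=> //; apply: sF => //.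
  apply: gplot_comp (chart_cod_open Ac) oW _ _ (gplot_chart Ac).
    by move=> z; rewrite prod_chart_cod => -[[]].
  exact: smooth_on_lsubmx.
apply: gplot_comp (chart_cod_open Ad) oW _ _ (gplot_chart Ad).
  by move=> z; rewrite prod_chart_cod => -[_ []].
exact: smooth_on_rsubmx.
Qed.

(** In the product chart both tangent vectors become directions of one Euclidean space, where
    [schwarz] applies to real and imaginary parts. *)
Lemma tangent_swap (G H : lieGroup R) (F : G -> H -> C) c d v w :
  lie_atlas c -> chart_dom c 1%g -> lie_atlas d -> chart_dom d 1%g -> jsmooth F ->
  tangent c v (fun x => tangent d w (F x)) =
  tangent d w (fun y => tangent c v (fun x => F x y)).
Proof.
move=> Ac c1 Ad d1 sF; have [oW sPhi] := jsmooth_charts Ac Ad sF.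
pose W := chart_cod (prod_chart c d).
pose Phi (z : 'rV[R]_(lie_dim G + lie_dim H)) :=
  F (chart_inv c (lsubmx z)) (chart_inv d (rsubmx z)).
have W1 : W (row_mx (c 1%g) (d 1%g)).
  by exists (1%g, 1%g).
have E (h : C -> R^o) : smooth_on W (fun z => h (Phi z)) ->
   'D_v (fun a => 'D_w (fun b => h (F (chart_inv c a) (chart_inv d b))) (d 1%g) : R^o) (c 1%g) =
   'D_w (fun b => 'D_v (fun a => h (F (chart_inv c a) (chart_inv d b))) (c 1%g) : R^o) (d 1%g).
  move=> sh.
  have E1 a : 'D_w (fun b => h (F (chart_inv c a) (chart_inv d b))) (d 1%g) =
      'D_(row_mx 0 w) (fun z => h (Phi z)) (row_mx a (d 1%g)).
    rewrite -derive_row_mx; congr ('D_w _ _).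
    by apply/funext => y; rewrite /Phi row_mxKl row_mxKr.
  have E2 b : 'D_v (fun a => h (F (chart_inv c a) (chart_inv d b))) (c 1%g) =
      'D_(row_mx v 0) (fun z => h (Phi z)) (row_mx (c 1%g) b).
    rewrite -derive_row_mxl; congr ('D_v _ _).
    by apply/funext => y; rewrite /Phi row_mxKl row_mxKr.
  rewrite (funext E1) (funext E2).
  rewrite (derive_row_mxl ('D_(row_mx 0 w) (fun z => h (Phi z)))).
  rewrite (derive_row_mx ('D_(row_mx v 0) (fun z => h (Phi z)))).
  exact: schwarz oW W1 sh.
case: sPhi => s1 s2.
exact: (f_equal2 (@Complex R) (E (@complex.Re R) s1) (E (@complex.Im R) s2)).
Qed.

(** A Fubini theorem for distributions. Linearity and convolution reduce it to two tangent vectors,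
    by an induction on [v] inside the tangent case of the induction on [u]. *)
Lemma inU_swap (G H : lieGroup R) (u : functional G) (v : functional H) F :
  inU u -> inU v -> jsmooth F ->
  u (fun x => v (F x)) = v (fun y => u (fun x => F x y)).
Proof.
move=> Uu; elim: Uu v F => {u} [g|c t Ac c1|a u1 u2 U1 IH1 U2 IH2|u1 u2 U1 IH1 U2 IH2]
  v F Uv sF.
- by [].
- elim: Uv F sF => {v} [g|d w Ad d1|a v1 v2 U1 IH1 U2 IH2|v1 v2 U1 IH1 U2 IH2] F sF.
  + by [].
  + exact: tangent_swap.
  + rewrite -IH1 // -IH2 // inU_linear //; first exact: inU_tangent.
      exact: jsmooth_apply_r.
    exact: jsmooth_apply_r.
  + rewrite /conv (IH1 (fun x h => v2 (fun h' => F x (h * h')%g)));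
      last exact: (jsmooth_mulr sF U2).
    congr v1; apply/funext => h; rewrite (IH2 (fun x h' => F x (h * h')%g)) //.
    exact: (jsmooth_sym (jsmooth_transl h (jsmooth_sym sF))).
- rewrite IH1 // IH2 // inU_linear //; exact: jsmooth_apply_l.
- rewrite /conv.
  rewrite -(IH1 v (fun g y => u2 (fun g' => F (g * g')%g y))) //; last exact: (jsmooth_mull sF U2).
  congr u1; apply/funext => g; rewrite (IH2 v (fun g' y => F (g * g')%g y)) //.
  exact: (jsmooth_transl g sF).
Qed.

End Swap.

(** * The involution on distributions *)

Section Star.
Variables (R : realType) (K : lieGroup R).
Local Notation C := R[i].

(** The chain rule in the chart [c], whose base point is fixed by inversion: [w] is the differential
    of inversion at the identity, applied to [v]. *)
Lemma tangent_inv (c : chart R K (lie_dim K)) v : lie_atlas c -> chart_dom c 1%g ->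
  exists w, forall f : K -> C, smoothC f ->
    tangent c v (fun x => f x^-1%g) = tangent c w f.
Proof.
move=> Ac c1.
have [cp sp] := gplotV (chart_cod_open Ac) (gplot_chart Ac).
have [HA _] := lie_cover K; have [oc oc' ic cc] := HA c Ac.
pose p y : K := (chart_inv c y)^-1%g.
pose V := chart_cod c `&` p @^-1` chart_dom c.
have oV : open V by exact: open_preimage_on oc' oc cp.
pose s y := c (p y).
have ss : smooth_on V s := sp c Ac.
have p1 : p (c 1%g) = 1%g by rewrite /p ic // invg1.
have V1 : V (c 1%g) by split; [exists 1%g|rewrite /= p1].
have s1 : s (c 1%g) = c 1%g by rewrite /s p1.
exists ('D_v s (c 1%g)) => f sf.
have E (g : K -> R^o) : smooth_on (chart_cod c) (g \o chart_inv c) ->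
    'D_v ((fun x => g x^-1%g) \o chart_inv c) (c 1%g) =
    'D_('D_v s (c 1%g)) (g \o chart_inv c) (c 1%g).
  move=> sg.
  have nE : \forall y \near c 1%g, ((g \o chart_inv c) \o s) y =
      ((fun x => g x^-1%g) \o chart_inv c) y.
    by apply: near_open oV _ V1 => y [_ cy]; rewrite /= /s ic.
  have dg : differentiable (g \o chart_inv c) (c 1%g).
    by apply: smooth_on_differentiable sg _; exists 1%g.
  have ds : differentiable s (c 1%g) := smooth_on_differentiable ss V1.
  rewrite -(near_eq_derive _ nE) deriveE; last first.
    by apply: differentiable_comp => //; rewrite s1.
  rewrite diff_comp ?s1 //= -(deriveE v ds) -deriveE //.
have [f1 f2] := sf c Ac.
exact: (f_equal2 (@Complex R) (E _ f1) (E _ f2)).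
Qed.

Lemma starU_inU (u : functional K) : inU u ->
  exists2 u', inU u' & forall f, smoothC f -> starU u f = u' f.
Proof.
elim=> {u} [g|c v Ac c1|a u v Uu [u' Uu' Hu] Uv [v' Uv' Hv]|u v Uu [u' Uu' Hu] Uv [v' Uv' Hv]].
- exists (grouplike g^-1%g); first exact: inU_grouplike.
  by move=> f _; rewrite /starU /grouplike conjcK.
- have [w Hw] := tangent_inv v Ac c1.
  exists (tangent c w); first exact: inU_tangent.
  move=> f sf; rewrite /starU (Hw (fun x => conjc (f x))); last exact: smoothC_conj.
  have [f1 f2] := sf c Ac.
  have d2 : derivable ((fun x => complex.Im (f x) : R^o) \o chart_inv c) (c 1%g) w.
    by apply/diff_derivable/(smooth_on_differentiable f2); exists 1%g.
  rewrite /tangent.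
  have -> : (fun x => complex.Re (conjc (f x)) : R^o) \o chart_inv c =
      (fun x => complex.Re (f x) : R^o) \o chart_inv c.
    by apply/funext => y /=; case: (f _).
  have -> : (fun x => complex.Im (conjc (f x)) : R^o) \o chart_inv c =
      - ((fun x => complex.Im (f x) : R^o) \o chart_inv c).
    by apply/funext => y /=; rewrite !fctE /=; case: (f _).
  by rewrite (deriveN d2) /= opprK.
- exists (fun f => conjc a * u' f + v' f); first exact: inU_lin.
  by move=> f sf; rewrite /starU rmorphD rmorphM /= -Hu // -Hv.
- exists (conv v' u'); first exact: inU_conv.
  move=> f sf; rewrite /starU /conv.
  have jF : jsmooth (fun g g' => conjc (f (g' ^-1 * g^-1)%g)).
    move=> m U p q oU gp gq.
    apply: (smoothC_plot (f := fun x => conjc (f x)) (p := fun x => ((q x)^-1 * (p x)^-1)%g)) => //.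
      by apply: gplotM => //; exact: gplotV.
    exact: smoothC_conj.
  have -> : (fun g => v (fun g' => conjc (f (g * g')^-1%g))) =
      (fun g => v (fun g' => conjc (f (g'^-1 * g^-1)%g))).
    by apply/funext => g; congr v; apply/funext => g'; rewrite invgM.
  (* Here [u] is applied outside [v], whereas in [conv v' u'] the outer distribution is the one
     coming from [v]. *)
  rewrite (inU_swap Uu Uv jF).
  rewrite -(Hv (fun g => u' (fun g' => f (g * g')%g))); last exact: (smoothC_conv Uu' sf).
  rewrite /starU; congr (conjc (v _)); apply/funext => g'.
  by rewrite -(Hu _ (smoothC_mull g'^-1%g sf)) /starU conjcK.
Qed.

End Star.

(** * Haar measure on a compact Lie group *)

Section Continuity.
Variables (R : realType) (K : lieGroup R).

Lemma lie_mul_continuous : continuous (fun p : K * K => (p.1 * p.2)%g).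
Proof. by move=> p; have [+ _] := lie_mul_smooth K; exact. Qed.

Lemma mull_continuous (k : K) : continuous (fun x : K => (k * x)%g).
Proof.
move=> x; apply: (@continuous_comp _ _ _ (fun x : K => (k, x)) (fun p : K * K => (p.1 * p.2)%g)).
  by apply: cvg_pair; [exact: cvg_cst|exact: cvg_id].
exact: lie_mul_continuous.
Qed.

Lemma lie_inv_continuous : continuous (fun x : K => x^-1%g).
Proof. by move=> x; have [+ _] := lie_inv_smooth K; exact. Qed.

End Continuity.

Section FiniteMeasure.
Context d (T : measurableType d) (R : realType) (mu : {measure set T -> \bar R}).
Hypothesis mu_fin : fin_num_fun mu.

(** The [let] makes the finiteness proof an argument of the term, so that the structure of finite
    measure, and with it product measures, can be attached to it. *)
Definition finMeasure : set T -> \bar R := let _ := mu_fin in mu.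
HB.instance Definition _ := Measure.copy finMeasure mu.
HB.instance Definition _ := Measure_isFinite.Build _ _ _ finMeasure mu_fin.

End FiniteMeasure.

Section Haar.
Variables (R : realType) (K : lieGroup R).
Local Notation C := R[i].
Local Notation B := (borelType K).

Lemma open_measurable_borel (A : set B) : @open K A -> measurable A.
Proof. by move=> oA; exact: sub_sigma_algebra. Qed.

Lemma continuous_measurable_real (f : K -> R) : continuous f ->
  measurable_fun setT (f : B -> R).
Proof.
move=> cf; apply: (measurability _ (measurable_realfun.RGenOpens.measurableE R)).
move=> _ [_ [a [b ->]] <-]; rewrite setTI; apply: open_measurable_borel.
by apply: open_comp => // x _; exact: cf.
Qed.

Lemma continuous_measurable_borel (f : K -> K) : continuous f ->
  measurable_fun setT (f : B -> B).
Proof.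
move=> cf; have H := @measurability _ _ B B setT (f : B -> B) (@open K) erefl.
apply: H; move=> _ [Q oQ <-]; rewrite setTI; apply: open_measurable_borel.
by apply: open_comp => // x _; exact: cf.
Qed.

(** The product sigma-algebra is generated by rectangles, not by the open sets of K x K. By second
    countability an open preimage is nevertheless a countable union of rectangles of basic open
    sets. *)
Lemma mul_measurable : measurable_fun setT (fun p : B * B => (p.1 * p.2)%g : B).
Proof.
have H := @measurability _ _ (B * B)%type B setT
  (fun p : B * B => (p.1 * p.2)%g : B) (@open K) erefl.
apply: H; move=> _ [Q oQ <-]; rewrite setTI.
have [D cD [oD bD]] := @lie_second_countable _ K.
pose P := [set UV : set K * set K | [/\ D UV.1, D UV.2 &
  UV.1 `*` UV.2 `<=` (fun p : K * K => (p.1 * p.2)%g) @^-1` Q]].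
rewrite (_ : _ @^-1` Q = \bigcup_(UV in P) (UV.1 `*` UV.2)); last first.
  apply/seteqP; split=> [[x y] /= Qxy|p [UV [_ _ UVQ] /UVQ//]].
  have : nbhs (x, y) ((fun p : K * K => (p.1 * p.2)%g) @^-1` Q).
    by apply: lie_mul_continuous; exact: open_nbhs_nbhs.
  move=> [[X Y] /= [nX nY] XY].
  have [U [DU Ux] UX] := bD x X nX; have [V [DV Vy] VY] := bD y Y nY.
  exists (U, V) => //; split=> // -[x' y'] [/= /UX ? /VY ?].
  exact: (XY (x', y')).
have cP : countable P.
  by apply: sub_countable (countableX cD cD); apply: subset_card_le => UV [].
rewrite bigcup_set_type; apply: countable_bigcupT_measurable.
  by rewrite (eq_countable (card_setT P)).
move=> [UV /=]; rewrite in_setE => -[DU DV _].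
by apply: measurableX; apply: open_measurable_borel; exact: oD.
Qed.


Section RightHaar.
Variable mu : {measure set B -> \bar R}.
Hypotheses (cK : compact [set: K]) (hmu : right_haar mu).

Lemma haar_finite : (mu setT < +oo)%E.
Proof. by have [H _ _] := hmu; exact: H. Qed.

Lemma haar_fin_num_fun : fin_num_fun mu.
Proof.
move=> A mA; rewrite ge0_fin_numE ?measure_ge0 //.
by apply: le_lt_trans haar_finite; apply: le_measure => //; rewrite inE.
Qed.

Definition invK : B -> B := fun x => x^-1%g.

Lemma invK_measurable : measurable_fun setT invK.
Proof. exact: continuous_measurable_borel (@lie_inv_continuous _ K). Qed.

Lemma preimage_measurable (f : K -> K) (A : set B) : continuous f ->
  measurable A -> measurable ((f : B -> B) @^-1` A).
Proof.
move=> cf mA; rewrite -[X in measurable X]setTI.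
exact: continuous_measurable_borel.
Qed.

Lemma haar_mulr (A : set B) (k : K) : measurable A ->
  mu [set x | A (x * k)%g] = mu A.
Proof.
move=> mA; have [_ _ H] := hmu.
rewrite -[in RHS](H A k^-1%g mA); congr (mu _).
apply/seteqP; split=> [x Axk|_ [x Ax <-]] /=; last by rewrite mulgVK.
by exists (x * k)%g => //; rewrite mulgK.
Qed.

(* Tonelli for the indicator of {(x, y) | x y \in A}, with mu and its image nu
   under inversion, gives mu(A) nu(K) = mu(K) nu(A). *)
Lemma haar_inv (A : set B) : measurable A -> mu [set x | A x^-1%g] = mu A.
Proof.
move=> mA.
have [nu nuE] : exists nu : {measure set B -> \bar R},
    forall E, nu E = mu [set x | E x^-1%g].
  by exists (@measure_function_pushforward__canonical__measure_function_Measure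
    _ _ _ _ _ mu _ invK_measurable).
have nu_fin : fin_num_fun nu.
  move=> E mE; rewrite nuE; apply: haar_fin_num_fun.
  exact: preimage_measurable (@lie_inv_continuous _ K) mE.
pose m1 : {sigma_finite_measure set B -> \bar R} := finMeasure haar_fin_num_fun.
pose m2 : {sigma_finite_measure set B -> \bar R} := finMeasure nu_fin.
pose X := (fun p : B * B => (p.1 * p.2)%g : B) @^-1` A.
have mX : measurable X.
  by rewrite -[X in measurable X]setTI; exact: mul_measurable.
have := @product_measure_unique _ _ B B R m1 m2 (m1 \x^ m2)%E
  (fun E F mE mF => @product_measure2E _ _ B B R m1 m2 E F mE mF) X mX.
rewrite /= /product_measure1 /product_measure2.
(* Inversion turns right invariance of [mu] into left invariance of [nu], so the sections of [X]
   have constant measure in either variable. *)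
have E1 x : (m2 \o xsection X) x = cst (nu A) x.
  have mA' : measurable [set y : B | A y^-1%g].
    exact: preimage_measurable (@lie_inv_continuous _ K) mA.
  rewrite /= [RHS]nuE -(haar_mulr x^-1%g mA') [LHS]nuE.
  congr (mu _); apply/seteqP; split=> y /=.
    by rewrite /xsection /= inE /X /= invgM invgK.
  by rewrite /xsection /= inE /X /= invgM invgK.
have E2 y : (m1 \o ysection X) y = cst (mu A) y.
  rewrite /= -(haar_mulr y mA).
  by congr (mu _); apply/seteqP; split=> x /=; rewrite /ysection /= inE.
rewrite (eq_integral (cst (nu A)) _ (fun x _ => E1 x)).
rewrite (eq_integral (cst (mu A)) _ (fun y _ => E2 y)).
rewrite !integral_cst // /m1 /m2 /= /finMeasure (nuE setT).
(* Thus nu(K) = mu(K), a positive finite number that cancels. *)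
have -> : [set x : B | [set: B] x^-1%g] = setT by apply/seteqP; split.
have T0 : (0 < mu setT)%E.
  by have [_ H _] := hmu; apply: H => //; [exact: openT|exists 1%g].
have Tf : mu setT \is a fin_num by exact: haar_fin_num_fun.
have Af : mu A \is a fin_num by exact: haar_fin_num_fun.
have nAf : nu A \is a fin_num := nu_fin A mA.
rewrite -(nuE A) -(fineK Tf) -(fineK Af) -(fineK nAf) -!EFinM => -[E].
congr (_%:E); apply: (mulIf _ E).
by apply/eqP => T00; move: T0; rewrite -(fineK Tf) T00 lte_fin ltxx.
Qed.

Lemma haar_mull (A : set B) (k : K) : measurable A ->
  mu [set x | A (k * x)%g] = mu A.
Proof.
move=> mA.
have mA1 : measurable [set x : B | A (k * x)%g].
  exact: preimage_measurable (@mull_continuous _ K k) mA.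
have mA2 : measurable [set x : B | A x^-1%g].
  exact: preimage_measurable (@lie_inv_continuous _ K) mA.
rewrite -(haar_inv mA1) -(haar_inv mA) -(haar_mulr k^-1%g mA2).
by congr (mu _); apply/seteqP; split=> x /=; rewrite invgM invgK.
Qed.

Lemma continuous_integrable (f : K -> R) : continuous f ->
  mu.-integrable setT (EFin \o (f : B -> R)).
Proof.
move=> cf; apply: measurable_bounded_integrable => //.
- exact: haar_finite.
- exact: continuous_measurable_real.
- have /compact_bounded : compact (f @` [set: K]).
    by apply: continuous_compact => //; exact: continuous_subspaceT.
  by move=> [M [Mr HM]]; exists M; split=> // r /HM H x _; apply: H; exists x.
Qed.

Lemma Rintegral_mull (f : K -> R) (k : K) : continuous f ->
  \int[mu]_(x in setT) f (k * x)%g = \int[mu]_(x in setT) f x.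
Proof.
move=> cf; have cfk : continuous (fun x => f (k * x)%g).
  by move=> x; apply: continuous_comp; [exact: mull_continuous|exact: cf].
have mphi := continuous_measurable_borel (@mull_continuous _ K k).
rewrite /Rintegral; congr fine.
have mf : @measurable_fun _ _ B (\bar R) setT (fun x => (f x)%:E).
  by apply/measurable_EFinP; exact: continuous_measurable_real.
have := @integral_pushforward _ _ B B R _ mphi mu setT _ mf
  (continuous_integrable cfk) measurableT.
rewrite preimage_setT => <-.
by apply: eq_measure_integral => A mA _; exact: haar_mull.
Qed.

End RightHaar.
End Haar.

(** * Distributions under the integral sign *)

Section Interchange.
Variables (R : realType) (G K : lieGroup R).
Local Notation C := R[i].
Variable mu : {measure set (borelType K) -> \bar R}.
Hypotheses (cK : compact [set: K]) (hmu : right_haar mu).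

Definition Cint (f : K -> C) : C :=
  Complex (\int[mu]_(x in setT) complex.Re (f x)) (\int[mu]_(x in setT) complex.Im (f x)).

Lemma Cint_linear (a : C) (f g : K -> C) : smoothC f -> smoothC g ->
  Cint (fun x => a * f x + g x) = a * Cint f + Cint g.
Proof.
move=> /smoothC_continuous[f1 f2] /smoothC_continuous[g1 g2]; case: a => a b.
have I1 := continuous_integrable cK hmu f1.
have I2 := continuous_integrable cK hmu f2.
have J1 := continuous_integrable cK hmu g1.
have J2 := continuous_integrable cK hmu g2.
have cZ (r : R) (h : K -> R) : continuous h -> continuous (fun x => r * h x).
  by move=> ch x; apply: continuousM; [exact: cst_continuous|exact: ch].
have H (r s : R) (h1 h2 h3 : K -> R) : continuous h1 -> continuous h2 -> continuous h3 ->
    \int[mu]_(x in setT) (r * h1 x + s * h2 x + h3 x) =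
    r * \int[mu]_(x in setT) h1 x + s * \int[mu]_(x in setT) h2 x +
    \int[mu]_(x in setT) h3 x.
  move=> c1 c2 c3.
  have c12 : continuous (fun x => r * h1 x + s * h2 x).
    by move=> x; exact: (continuousD (cZ _ _ c1 x) (cZ _ _ c2 x)).
  rewrite RintegralD //; [|exact: continuous_integrable..].
  rewrite RintegralD //; [|exact/continuous_integrable/cZ..].
  by rewrite !RintegralZl //; exact: continuous_integrable.
rewrite /Cint.
have -> : (fun x => complex.Re ((a +i* b)%C * f x + g x)) =
    fun x => a * complex.Re (f x) + (- b) * complex.Im (f x) + complex.Re (g x).
  by apply/funext => x; rewrite Re_cadd Re_cmul mulNr.
have -> : (fun x => complex.Im ((a +i* b)%C * f x + g x)) =
    fun x => a * complex.Im (f x) + b * complex.Re (f x) + complex.Im (g x).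
  by apply/funext => x; rewrite Im_cadd Im_cmul.
by rewrite !H // mulNr.
Qed.

Lemma Cint_mull (f : K -> C) (k : K) : smoothC f ->
  Cint (fun x => f (k * x)%g) = Cint f.
Proof.
move=> /smoothC_continuous[f1 f2]; rewrite /Cint.
by rewrite (Rintegral_mull cK hmu k f1) (Rintegral_mull cK hmu k f2).
Qed.

(** Dominated differentiation along the line through c(1) in the direction [v]; compactness of K
    supplies the dominating constant. The function [h] stands for the real or the imaginary part. *)
Lemma derive_Rintegral (F : G -> K -> C) (h : C -> R^o) c v :
  (forall m (U : set 'rV[R]_m) f, csmooth_on U f -> smooth_on U (fun x => h (f x))) ->
  (forall f : K -> C, smoothC f -> continuous (fun x => h (f x))) ->
  jsmooth F -> lie_atlas c -> chart_dom c 1%g ->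
  'D_v (fun y => \int[mu]_(x in setT) h (F (chart_inv c y) x) : R^o) (c 1%g) =
  \int[mu]_(x in setT) 'D_v (fun y => h (F (chart_inv c y) x)) (c 1%g).
Proof.
move=> hs hc sF Ac c1.
pose phi (t : R) x : R := h (F (chart_inv c (c 1%g + t *: v)) x).
pose psi t x := 'D_v (fun y => h (F (chart_inv c y) x)) (c 1%g + t *: v).
have cc1 : chart_cod c (c 1%g) by exists 1%g.
have oc := chart_cod_open Ac.
have ctv : continuous (fun t : R => c 1%g + t *: v).
  move=> t; apply: (@continuousD _ _ _ (fun=> c 1%g) (fun t : R => t *: v)).
    exact: cst_continuous.
  by apply: continuousZr_tmp => ?; exact.
have [HA cA] := lie_cover K; have [HG _] := lie_atlasP K.
(* The near-covering form of compactness wants one filter for all points, while a local bound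
   depends on [x0]. The bound is therefore made a variable tending to infinity, next to t tending to
   0. *)
have loc (x0 : K) : \forall x' \near x0 & i \near filter_prod (nbhs (0 : R)) (pinfty_nbhs R),
    `|psi i.1 x'| <= i.2.
  have [d Ad dx0] := cA x0; have [od od' id' _] := HA d Ad.
  have [_ _ _ cd _] := HG d Ad.
  have [oW sPhi] := jsmooth_charts Ac Ad sF.
  (* For x' near [x0], the derivatives [psi t x'] are values of this one function of all
     coordinates, continuous and hence bounded near the point given by t = 0 and [x0]. *)
  pose D : 'rV[R]_(lie_dim G + lie_dim K) -> R^o := 'D_(row_mx v 0)
    (fun z => h (F (chart_inv c (lsubmx z)) (chart_inv d (rsubmx z)))).
  have sD : smooth_on (chart_cod (prod_chart c d)) D.
    by apply: smooth_on_derive; exact: hs.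
  pose q (p : K * R) := row_mx (c 1%g + p.2 *: v) (d p.1).
  have cq : {for (x0, 0), continuous q}.
    have -> : q = (fun p => row_mx (c 1%g + p.2 *: v) 0 + row_mx 0 (d p.1)).
      by apply/funext => p; rewrite /q add_row_mx addr0 add0r.
    apply: (@continuousD _ _ _ (fun p : K * R => row_mx (c 1%g + p.2 *: v) 0)
      (fun p : K * R => row_mx 0 (d p.1))).
      apply: (@continuous_comp _ _ _ (fun p : K * R => c 1%g + p.2 *: v) (fun y => row_mx y 0)).
        apply: (@continuous_comp _ _ _ (fun p : K * R => p.2) (fun t : R => c 1%g + t *: v)).
          exact: cvg_snd.
        exact: ctv.
      apply: (smooth_on_continuous (U := setT)) => //.
      by apply: smooth_on_row_mx; [exact: openT|exact: smooth_on_id|exact: smooth_on_cst].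
    apply: (@continuous_comp _ _ _ (fun p : K * R => d p.1) (fun y => row_mx 0 y)).
      apply: (@continuous_comp _ _ _ (fun p : K * R => p.1) d).
        exact: cvg_fst.
      exact: cd.
    apply: (smooth_on_continuous (U := setT)) => //.
    by apply: smooth_on_row_mx; [exact: openT|exact: smooth_on_cst|exact: smooth_on_id].
  have z0W : chart_cod (prod_chart c d) (q (x0, 0)).
    by exists (1%g, x0) => //; rewrite /q /= scale0r addr0.
  pose M0 := `|D (q (x0, 0))| + 1.
  have nN : nbhs (q (x0, 0)) [set z | `|D z| < M0].
    have cN : {for q (x0, 0), continuous (fun z => `|D z| : R)}.
      apply: continuous_comp; last exact: norm_continuous.
      exact: smooth_on_continuous sD z0W.
    apply: (cN [set y | y < M0]); apply: open_nbhs_nbhs.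
    by split; [exact: open_lt|rewrite /= /M0 ltrDl].
  have [[A B] /= [nA nB] AB] := cq _ nN.
  exists (A `&` chart_dom d, B `*` [set M | M0 <= M]) => /=.
    split; first by apply: filterI => //; exact: open_nbhs_nbhs.
    exists (B, [set M | M0 <= M]) => //=; split => //.
    by apply: nbhs_pinfty_ge; exact: num_real.
  move=> [x' [t M]] /= [[Ax' dx'] [Bt MM]].
  apply: le_trans MM; apply: ltW.
  have -> : psi t x' = D (q (x', t)); last exact: (AB (x', t)).
  rewrite /psi /q /D /= -derive_row_mxl; congr ('D_v _ _).
  by apply/funext => y; rewrite row_mxKl row_mxKr id'.
have [eps [M [e0 M0 epsM]]] : exists eps M : R, [/\ 0 < eps, 0 <= M &
    forall t, `|t| < eps -> chart_cod c (c 1%g + t *: v) /\ forall x, `|psi t x| <= M].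
  have [[A B] /= [nA [N [_ HN]]] AB] := (compact_near_coveringP _).1 cK _ _ _ _ (fun x _ => loc x).
  have nA' : nbhs (0 : R) (A `&` [set t | chart_cod c (c 1%g + t *: v)]).
    apply: filterI => //; apply: ctv; apply: open_nbhs_nbhs; split=> //.
    by rewrite scale0r addr0.
  move/nbhs_ballP: nA' => [e e0 He].
  (* Beyond the threshold [N] of the filter at infinity, and nonnegative. *)
  exists e, (`|N| + 1); split=> //; move=> t te; 
  have [] : (A `&` [set t | chart_cod c (c 1%g + t *: v)]) t.
    by apply: He; rewrite -ball_normE /= sub0r normrN.
  move=> At ct; split=> // x; apply: (AB (t, `|N| + 1)) => //; split=> //=.
  by apply: HN; rewrite (le_lt_trans (ler_norm N)) // ltrDl.
have dphi (t : R) x : `|t| < eps -> is_derive t 1 (fun t => phi t x : R^o) (psi t x).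
  move=> /epsM[ct _]; apply: (@is_derive_line _ _ R^o (fun y => h (F (chart_inv c y) x))).
  apply/diff_derivable/smooth_on_differentiable; last exact: ct.
  apply: hs; have [s1 s2] := jsmooth_l x sF Ac; by split.
have itv t : `]- eps, eps[%classic t -> `|t| < eps by rewrite /= in_itv /= ltr_norml.
have I0 : `]- eps, eps[%classic 0 by rewrite /= in_itv /= oppr_lt0 e0.
have intphi t : `]- eps, eps[%classic t ->
    mu.-integrable setT (EFin \o (phi t : borelType K -> R)).
  move=> _; apply: (continuous_integrable cK hmu); apply: hc; exact: jsmooth_r.
have derphi t x : `]- eps, eps[%classic t -> [set: borelType K] x -> derivable (phi ^~ x) t 1.
  by move=> /itv tI _; have [] := dphi t x tI.
have pE t x : `|t| < eps -> partial1of2 phi t x = psi t x.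
  by move=> tI; rewrite partial1of2E; have [_ ->] := dphi t x tI.
have bound t x : `]- eps, eps[%classic t -> [set: borelType K] x ->
    `|partial1of2 phi t x| <= cst M x.
  by move=> /itv tI _; rewrite pE //; have [_] := epsM t tI; exact.
have intM : mu.-integrable setT (EFin \o (cst M : borelType K -> R)).
  by apply: (continuous_integrable cK hmu); exact: cst_continuous.
have := @differentiation_under_integral R _ (borelType K) mu phi setT measurableT 0
  (- eps) eps I0 intphi derphi (cst M) (fun=> M0) intM bound.
rewrite derive1E => E.
transitivity ('D_1 (fun t => \int[mu]_(y in setT) phi t y : R^o) (0 : R)).
  apply: eq_derive_line => t.
  by rewrite /phi addr0 [t *: 1]mulr1 addrC.
rewrite E; apply: eq_Rintegral => x _.
by rewrite pE ?normr0 // /psi scale0r addr0.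
Qed.

(** The induction is that of [inU_swap], with integration over K in the role of the second
    distribution. *)
Lemma inU_Cint (u : functional G) (F : G -> K -> C) : inU u -> jsmooth F ->
  u (fun g => Cint (F g)) = Cint (fun x => u (fun g => F g x)).
Proof.
move=> Uu; elim: Uu F => {u} [g|c t Ac c1|a u1 u2 U1 IH1 U2 IH2|u1 u2 U1 IH1 U2 IH2] F sF.
- by [].
- have H1 := derive_Rintegral (h := @complex.Re R) t (fun _ _ _ s => s.1)
    (fun _ s => (smoothC_continuous s).1) sF Ac c1.
  have H2 := derive_Rintegral (h := @complex.Im R) t (fun _ _ _ s => s.2)
    (fun _ s => (smoothC_continuous s).2) sF Ac c1.
  exact: (f_equal2 (@Complex R) H1 H2).
- by rewrite IH1 // IH2 // Cint_linear //; exact: jsmooth_apply_l.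
- rewrite /conv -(IH1 (fun g x => u2 (fun g' => F (g * g')%g x))); last exact: (jsmooth_mull sF U2).
  congr u1; apply/funext => g; rewrite (IH2 (fun g' x => F (g * g')%g x)) //.
  exact: (jsmooth_transl g sF).
Qed.

End Interchange.

(** * Adjoints for the inner product *)

Section Unitarity.
Variables (R : realType) (K : lieGroup R).
Local Notation C := R[i].
Variable mu : {measure set (borelType K) -> \bar R}.
Hypotheses (cK : compact [set: K]) (hmu : right_haar mu).

Lemma L2dotE (f g : K -> C) : L2dot mu f g = Cint mu (fun x => conjc (f x) * g x).
Proof. by []. Qed.

Lemma smoothC_square_integrable (f : K -> C) : smoothC f -> square_integrable mu f.
Proof.
move=> /smoothC_continuous[f1 f2]; split; try exact: continuous_measurable_real.
apply: integrable_lty => //.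
apply: (continuous_integrable cK hmu) => x.
apply: (@continuousD _ _ _ (fun x => complex.Re (f x) ^+ 2) (fun x => complex.Im (f x) ^+ 2)).
  exact: (continuousM (f1 x) (f1 x)).
exact: (continuousM (f2 x) (f2 x)).
Qed.

Lemma Cint_conj (f : K -> C) : smoothC f -> Cint mu (fun x => conjc (f x)) = conjc (Cint mu f).
Proof.
move=> /smoothC_continuous[_ f2]; rewrite /Cint /=; congr Complex.
  by apply: eq_Rintegral => x _; case: (f x).
rewrite -[RHS]mulN1r -RintegralZl //; last exact: (continuous_integrable cK hmu f2).
by apply: eq_Rintegral => x _; rewrite mulN1r; case: (f x).
Qed.

Lemma Cint_sum n (F : 'I_n -> K -> C) : (forall i, smoothC (F i)) ->
  Cint mu (fun x => \sum_(i < n) F i x) = \sum_(i < n) Cint mu (F i).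
Proof.
have Cint0 : Cint mu (fun=> 0) = 0.
  by rewrite /Cint /= !Rintegral_cst // !mul0r.
elim: n F => [|n IHn] F sF.
  rewrite big_ord0 -Cint0; congr (Cint mu _).
  by apply/funext => x; rewrite big_ord0.
rewrite big_ord_recl -IHn // -[Cint mu (F ord0)]mul1r -(Cint_linear cK hmu) //.
  congr (Cint mu _).
  by apply/funext => x; rewrite big_ord_recl mul1r.
exact: smoothC_sum.
Qed.

(** The distribution is pulled out of the integral, x is replaced by k^-1 x for each k separately by
    left invariance, and the distribution is put back. *)
Lemma Cint_adjoint (u : functional K) (f g : K -> C) :
  inU u -> smoothC f -> smoothC g ->
  Cint mu (fun x => u (fun k => f (k * x)%g) * g x) =
  Cint mu (fun x => f x * u (fun k => g (k^-1 * x)%g)).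
Proof.
move=> Uu sf sg.
have jF : jsmooth (fun k x => g x * f (k * x)%g).
  move=> m U p q oU gp gq; apply: csmooth_onM => //; first exact: smoothC_plot.
  by apply: (smoothC_plot (p := fun x => (p x * q x)%g)) => //; exact: gplotM.
have jG : jsmooth (fun k x => f x * g (k^-1 * x)%g).
  move=> m U p q oU gp gq; apply: csmooth_onM => //; first exact: smoothC_plot.
  apply: (smoothC_plot (p := fun x => ((p x)^-1 * q x)%g)) => //.
  by apply: gplotM => //; exact: gplotV.
transitivity (u (fun k => Cint mu (fun x => g x * f (k * x)%g))).
  rewrite (inU_Cint cK hmu Uu jF); congr (Cint mu _); apply/funext => x.
  rewrite mulrC inUZ //; exact: smoothC_mulr.
transitivity (u (fun k => Cint mu (fun x => f x * g (k^-1 * x)%g))).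
  congr u; apply/funext => k.
  have sgk : smoothC (fun x => g x * f (k * x)%g).
    by apply: smoothCM => //; exact: smoothC_mull.
  rewrite -(Cint_mull cK hmu k^-1%g sgk); congr (Cint mu _).
  by apply/funext => x; rewrite mulVKg mulrC.
rewrite (inU_Cint cK hmu Uu jG); congr (Cint mu _); apply/funext => x.
rewrite inUZ //; apply: (smoothC_inv (f := fun k => g (k * x)%g)); exact: smoothC_mulr.
Qed.

Lemma L2dot_starU (u : functional K) (f g : K -> C) :
  inU u -> smoothC f -> smoothC g ->
  Cint mu (fun x => conjc (u (fun k => f (k * x)%g)) * g x) =
  Cint mu (fun x => conjc (f x) * starU u (fun k => g (k * x)%g)).
Proof.
move=> Uu sf sg; have sgb := smoothC_conj sg.
have E1 : (fun x => conjc (u (fun k => f (k * x)%g)) * g x) =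
    fun x => conjc (u (fun k => f (k * x)%g) * conjc (g x)).
  by apply/funext => x; rewrite rmorphM /= conjcK.
have E2 : (fun x => conjc (f x) * starU u (fun k => g (k * x)%g)) =
    fun x => conjc (f x * u (fun k => conjc (g (k^-1 * x)%g))).
  by apply/funext => x; rewrite rmorphM.
rewrite E1 E2 !Cint_conj //; last first.
- apply: smoothCM => //; exact: (smoothC_right_conv Uu sf).
- apply: smoothCM => //; apply: smoothCP => U p oU gp; apply: inU_sfam => //.
  move=> k V s q oV VU ss gq.
  apply: (smoothC_plot (f := fun x => conjc (g x)) (p := fun y => ((q y)^-1 * p (s y))%g)) => //.
  apply: gplotM => //; first exact: gplotV.
  exact: gplot_comp oU oV VU ss gp.
by rewrite (Cint_adjoint Uu sf sgb).
Qed.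

End Unitarity.

Section InducedUnitary.
Variables (R : realType) (K L : lieGroup R) (mp : matched_pair K L) (l : L).
Local Notation C := R[i].
Hypothesis gl : global_at mp l.

(** Uniqueness of the action, applied twice, turns the relation into a formula; for the second
    factor it is applied through [inH_sm], as [starU u] is known only on smooth functions. *)
Lemma ind_act_starE (u : functional K) (lam : L -> C) (f g : K -> C) :
  inU u -> smoothC lam -> smoothC f -> ind_act_star mp l f u lam g ->
  g = fun x => starU u (fun k => f (k * x)%g * conjc (lam (lact mp (k * x)%g l))).
Proof.
move=> Uu sl sf [psi /[dup] [[spsi _]] Hpsi Hg].
have slb : smoothC (starF lam) by exact: smoothC_conj.
have psiE := ind_actE gl (inH_sm_inH (inH_Felt K slb)) sf Hpsi.
have [u' Uu' Hu'] := starU_inU Uu.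
have sm : inH_sm (tens (starU u) (fun=> 1) : hfam K L).
  exists 1%N, (fun=> u'), (fun=> fun=> 1); split.
    by move=> _; split=> //; exact: smoothC_cst.
  by move=> l' kap sk; rewrite /tens_sum big_ord1 /tens Hu'.
rewrite (ind_actE gl sm spsi Hg) psiE actH_Felt.
by apply/funext => x; rewrite /actH /tens mulr1.
Qed.

Lemma induced_unitary (mu : {measure set (borelType K) -> \bar R}) n
    (u : 'I_n -> functional K) (lam : 'I_n -> L -> C) (f g f1 : K -> C)
    (chi : 'I_n -> K -> C) :
  compact [set: K] -> right_haar mu ->
  (forall i, inU (u i) /\ smoothC (lam i)) -> smoothC f -> smoothC g ->
  ind_act mp l f (tens_sum u lam) f1 ->
  (forall i, ind_act_star mp l g (u i) (lam i) (chi i)) ->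
  L2dot mu f1 g = L2dot mu f (fun x => \sum_(i < n) chi i x).
Proof.
move=> cK hmu Hul sf sg Hf Hchi.
have Hh : inH (tens_sum u lam) by exists n, u, lam.
have schi i : smoothC (chi i) by have [psi _ []] := Hchi i.
(* The image of [g] under the conjugate of [lam i]. In [actH] the factor lam_i(x |> l) stays outside
   [u i], so it can be moved over to [g] before the adjoint of [u i] is taken. *)
pose psi i x := g x * conjc (lam i (lact mp x l)).
have spsi i : smoothC (psi i).
  have [_ sl] := Hul i; apply: smoothCM => //.
  exact: (smoothC_conj (smoothC_lact gl sl)).
rewrite (ind_actE gl (inH_sm_inH Hh) sf Hf) !L2dotE.
transitivity (Cint mu (fun x => \sum_(i < n)
    conjc (u i (fun k => f (k * x)%g)) * psi i x)).
  congr (Cint mu _); apply/funext => x.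
  rewrite /actH /tens_sum rmorph_sum mulr_suml; apply: eq_bigr => i _.
  by rewrite /tens rmorphM -mulrA [conjc (lam _ _) * _]mulrC.
rewrite (Cint_sum cK hmu); last first.
  move=> i; have [Ui _] := Hul i; apply: smoothCM => //.
  exact: (smoothC_conj (smoothC_right_conv Ui sf)).
transitivity (\sum_(i < n) Cint mu (fun x => conjc (f x) * chi i x)).
  apply: eq_bigr => i _; have [Ui sl] := Hul i.
  rewrite (L2dot_starU cK hmu Ui sf (spsi i)); congr (Cint mu _).
  by apply/funext => x; rewrite (ind_act_starE Ui sl sg (Hchi i)).
rewrite -(Cint_sum cK hmu); last by move=> i; apply: smoothCM => //; exact: smoothC_conj.
by congr (Cint mu _); apply/funext => x; rewrite mulr_sumr.
Qed.

End InducedUnitary.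

Theorem theorem4p3 (R : realType) (K L : lieGroup R) (mp : matched_pair K L)
    (l : L) (hl : global_at mp l) :
  [/\ (* (i) *)
      [/\ ind_carrier mp l = [set elt kap l | kap in @smoothC R K],
          set_bij (@smoothC R K) (ind_carrier mp l) (fun kap => elt kap l),
          forall (a : R[i]) (kap kap' : K -> R[i]),
            smoothC kap -> smoothC kap' ->
            elt (fun k => a * kap k + kap' k) l
            = (fun h : Hel K L => a * elt kap l h + elt kap' l h) &
          forall (f : hdual K L) (h : hfam K L), ind_carrier mp l f -> inH h ->
            exists! f', ind_carrier mp l f' /\ rreg mp f h f'],
      (* (ii) *)
      forall kap : K -> R[i], smoothC kap ->
        (forall k : K, ind_act mp l kap (@Kelt R K L k) (fun x => kap (k * x)%g)) /\
        (forall lam : L -> R[i], smoothC lam ->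
           ind_act mp l kap (@Felt R K L lam) (fun x => kap x * lam (lact mp x l))),
      (* (iii) *)
      (forall k : K, module_iso mp (ind_carrier mp l) (ind_carrier mp (lact mp k l))) /\
      (exists Phi : set L -> set (set (hdual K L)),
         set_bij (global_orbits mp) (induced_classes mp) Phi /\
         (forall l' : L, global_at mp l' ->
            Phi (Korbit mp l') = iso_class mp l')) &
      (* (iv) *)
      compact [set: K] ->
      forall mu : {measure set (borelType K) -> \bar R}, right_haar mu ->
        [/\ forall phi : K -> R[i], smoothC phi -> square_integrable mu phi,
            forall (k : K) (phi phi' : K -> R[i]), smoothC phi -> smoothC phi' ->
              L2dot mu (fun x => phi (k * x)%g) (fun x => phi' (k * x)%g)
              = L2dot mu phi phi' &
            forall n (u : 'I_n -> functional K) (lam : 'I_n -> L -> R[i])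
                (phi phi' phi1 : K -> R[i]) (chi : 'I_n -> K -> R[i]),
              (forall i, inU (u i) /\ smoothC (lam i)) ->
              smoothC phi -> smoothC phi' ->
              ind_act mp l phi (tens_sum u lam) phi1 ->
              (forall i, ind_act_star mp l phi' (u i) (lam i) (chi i)) ->
              L2dot mu phi1 phi' = L2dot mu phi (fun x => \sum_(i < n) chi i x)]].
Proof.
split.
- split; [exact: ind_carrierE|exact: elt_bij|exact: elt_linear|].
  by move=> f h; exact: ind_carrier_action.
- move=> kap sk; split=> [k|lam sl].
    by rewrite -(actH_Kelt mp l); apply: ind_act_actH => //; exact: inH_Kelt.
  by rewrite -actH_Felt; apply: ind_act_actH => //; exact: inH_Felt.
- split; last exact: orbit_correspondence.
  by move=> k; exact: module_iso_lact.
- move=> cK mu hmu; split.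
  + by move=> phi sphi; exact: smoothC_square_integrable.
  + move=> k phi phi' sp sp'; rewrite !L2dotE.
    apply: (Cint_mull cK hmu k (f := fun x => conjc (phi x) * phi' x)).
    by apply: smoothCM => //; exact: smoothC_conj.
  + by move=> n u lam phi phi' phi1 chi; exact: induced_unitary.
Qed.
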